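(* Let $\gamma$ be a translation invariant specification, $\nu\in\mathcal G_{\mathrm{inv}}(\gamma)$ and $\mu\in\mathcal M_{1,\mathrm{inv}}^+$, and assume $\mu(\Omega_\gamma^{<0})=1$. Then: 1. $h(\mu|\nu)$ exists if and only if $e_\nu^+$ exists, and then $$h(\mu|\nu)=e_\nu^+-h(\mu)-\int_\Omega\log\frac{\gamma_0(\sigma^+|\sigma^+)}{\gamma_0(+|\sigma^+)}\,\mu(d\sigma).$$ 2. If moreover $\mu\in\mathcal G_{\mathrm{inv}}(\gamma)$ and $e_\nu^+$ exists, then $$h(\mu|\nu)=\lim_{\Lambda\uparrow\mathbb Z^d}\frac1{|\Lambda|}\log\frac{\mu(+_\Lambda)}{\nu(+_\Lambda)}.$$
   Context: $E$ is a finite set, $\Omega=E^{\mathbb Z^d}$ with product topology and Borel $\sigma$-field $\mathcal F$. $\mathcal S$ is the set of finite subsets of $\mathbb Z^d$; $\mathcal F_\Lambda$ is the $\sigma$-field generated by the coordinates in $\Lambda$; $\sigma_\Lambda$ is the restriction of $\sigma$ to $\Lambda$, and $\mu(\sigma_\Lambda)$ is the $\mu$-probability of the corresponding cylinder. A function is local if it is $\mathcal F_\Delta$-measurable for some $\Delta\in\mathcal S$. Translations: $(\tau_x\omega)(y)=\omega(x+y)$. $\mathcal M_{1,\mathrm{inv}}^+$ is the set of translation invariant probability measures on $\Omega$. A specification is a family $\gamma=\{\gamma_\Lambda\}_{\Lambda\in\mathcal S}$ of probability kernels from $\Omega_{\Lambda^c}=E^{\Lambda^c}$ to $\mathcal F$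 that is proper ($\gamma_\Lambda(B|\omega)=\mathbf 1_B(\omega)$ for $B\in\mathcal F_{\Lambda^c}$, all $\omega$) and consistent ($\gamma_{\Lambda'}\gamma_\Lambda=\gamma_{\Lambda'}$ for $\Lambda\subset\Lambda'$, everywhere). $\gamma_\Lambda(\sigma|\omega)$ denotes the $\gamma_\Lambda(\cdot|\omega)$-probability of $\{\omega':\omega'_\Lambda=\sigma_\Lambda\}$, $\gamma_0=\gamma_{\{0\}}$, and $\gamma_\Lambda f(\omega)=\int f\,d\gamma_\Lambda(\cdot|\omega)$. All specifications are assumed non-null: for each $\Lambda\in\mathcal S$ there are $0<a_\Lambda<b_\Lambda<1$ with $a_\Lambda<\inf_{\sigma,\eta}\gamma_\Lambda(\sigma|\eta)\le\sup_{\sigma,\eta}\gamma_\Lambda(\sigma|\eta)<b_\Lambda$. $\gamma$ is translation invariant if $\gamma_{\Lambda+x}(A|\omega)=\gamma_\Lambda(\tau_xA|\tau_x\omega)$. $\mathcal G(\gamma)$ is the set of probability measures $\mu$ with $\mu[A|\mathcal F_{\Lambda^c}]=\gamma_\Lambda(A|\cdot)$ $\mu$-a.s. for all $A\in\mathcal F,\Lambda\in\mathcal S$; $\mathcal G_{\mathrm{inv}}(\gamma)$ is the set of its translation invariant elements. $\Omega_\gamma$ is the set of $\omega$ such that $\gamma_\Lambda f$ is continuous at $\omega$ for all $\Lambda\in\mathcal S$ and all local $f$. A value $+1\in E$ is fixed; $+$ is the configuration identically $+1$ and $+_\Lambda$ its restriction to $\Lambda$. For $\sigma\in\Omega$, $\sigma^+(x)=\sigma(x)$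 if $x\le0$ and $\sigma^+(x)=+1$ if $x>0$, with $\le$ the lexicographic order on $\mathbb Z^d$. $\Omega_\gamma^{<0}=\{\sigma\in\Omega:\sigma^+\in\Omega_\gamma\}$. $\Lambda_n=[-n,n]^d\cap\mathbb Z^d$ (this may be replaced by a Van Hove sequence), and all limits $\Lambda\uparrow\mathbb Z^d$ are taken along this sequence. $e_\nu^+=-\lim_{\Lambda\uparrow\mathbb Z^d}|\Lambda|^{-1}\log\nu(+_\Lambda)$ whenever the limit exists. $h(\mu)=-\lim_n|\Lambda_n|^{-1}\sum_{\sigma_{\Lambda_n}}\mu(\sigma_{\Lambda_n})\log\mu(\sigma_{\Lambda_n})$ is the Kolmogorov–Sinai entropy. $h(\mu|\nu)=\lim_n|\Lambda_n|^{-1}h_{\Lambda_n}(\mu|\nu)$ when the limit exists, where $h_\Lambda(\mu|\nu)=\sum_{\sigma_\Lambda}\mu(\sigma_\Lambda)\log\frac{\mu(\sigma_\Lambda)}{\nu(\sigma_\Lambda)}$ if $\mu_\Lambda\ll\nu_\Lambda$ (marginals on $E^\Lambda$) and $+\infty$ otherwise. *)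

(* Defs.v *)
From HB Require Import structures.
From mathcomp Require Import all_boot all_order all_algebra finmap.
From mathcomp Require Import all_classical all_reals all_analysis.
From mathcomp Require Import measurable_realfun.
From mathcomp Require Import zify.

Set Implicit Arguments.
Unset Strict Implicit.
Unset Printing Implicit Defensive.

Import Order.TTheory GRing.Theory Num.Theory.
Import numFieldNormedType.Exports.

Local Open Scope classical_set_scope.
Local Open Scope ring_scope.
Local Open Scope ereal_scope.

Notation lattice d := ('rV[int]_d).

Definition lex_coords (d : nat) (x : lattice d) : d.-tuplelexi int :=
  [tuple x ord0 i | i < d].

(* Lexicographic order on the lattice, the 0-th coordinate being the most
   significant one. *)
Definition lex_le (d : nat) (x y : lattice d) : bool :=
  (lex_coords x <= lex_coords y)%O.

Definition fset_translate (d : nat) (L : {fset lattice d}) (x : lattice d) :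
  {fset lattice d} := [fset (y + x)%R | y in L]%fset.

Definition box (d n : nat) : {fset lattice d} :=
  [fset (\row_i ((f i)%:Z - n%:Z))%R |
    f : {ffun 'I_d -> 'I_n.*2.+1} in predT]%fset.

Lemma in_box (d n : nat) (x : lattice d) :
  (x \in box d n) = [forall i, `|x ord0 i|%N <= n]%N.
Proof.
apply/imfsetP/forallP => [[f _ ->] i|xn].
  rewrite mxE; have := ltn_ord (f i); move: (nat_of_ord (f i)) => k; lia.
have lt_x i : (`|(x ord0 i + n%:Z)%R|%N < n.*2.+1)%N.
  by have := xn i; move: (x ord0 i) => k; lia.
exists [ffun i => Ordinal (lt_x i)] => //.
apply/rowP => i; rewrite mxE ffunE [0%R in LHS](_ : _ = ord0) //=.
by have := xn i; move: (x ord0 i) => k; lia.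
Qed.

(* Configurations. The distinguished spin is a parameter of the type only
   because a measurableType has to be pointed. *)
Definition config (E : finType) (plus : E) (d : nat) : Type :=
  {ptws lattice d -> discrete_topology E}.

Section config_instances.
Variables (E : finType) (plus : E) (d : nat).

HB.instance Definition _ := Topological.copy (config plus d)
  {ptws lattice d -> discrete_topology E}.
HB.instance Definition _ := isPointed.Build (config plus d) (fun=> plus).
HB.instance Definition _ := Measurable.copy (config plus d)
  (g_sigma_algebraType (@open (config plus d))).

End config_instances.

Section configurations.
Variables (E : finType) (plus : E) (d : nat).
Local Notation Omega := (config plus d).
Implicit Types (L : {fset lattice d}) (S : set (lattice d)).

Definition coord_sets S : set (set Omega) :=
  [set A | exists2 x, S x & exists B : set E, A = [set w | B (w x)]].

Definition sigma_coord S : set (set Omega) := <<s coord_sets S >>.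

(* The space Omega equipped with the sigma-field of the coordinates in S. *)
Definition config_on S := g_sigma_algebraType (coord_sets S).

Definition off L : set (lattice d) := ~` [set` L].

Definition restr L (w : Omega) : {ffun L -> E} := [ffun x : L => w (val x)].

Definition cylinder L (s : {ffun L -> E}) : set Omega :=
  [set w | restr L w = s].

Definition translate (x : lattice d) (w : Omega) : Omega := fun y => w (x + y)%R.

Definition all_plus : Omega := fun=> plus.

Definition plus_future (s : Omega) : Omega :=
  fun x => if lex_le x 0%R then s x else plus.

Definition local_fun (R : realType) (f : Omega -> R) : Prop :=
  exists D : {fset lattice d},
    measurable_fun [set: config_on [set` D]] f.

End configurations.

Arguments all_plus {E} plus {d}.

(* A kernel from E^(complement of L) is represented by a kernel on Omega which
   is measurable with respect to the coordinates outside L. *)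
Record specification (R : realType) (E : finType) (plus : E) (d : nat) := Spec {
  kern :> forall L : {fset lattice d},
    R.-pker (config_on plus (off L)) ~> config plus d ;
  spec_proper : forall L (B : set (config plus d)) (w : config plus d),
    sigma_coord (off L) B -> kern L w B = (\1_B w)%:E ;
  spec_consistent : forall L L' (A : set (config plus d)) (w : config plus d),
    (L `<=` L')%fset -> measurable A ->
    \int[kern L' w]_x kern L x A = kern L' w A }.

Section specifications.
Variables (R : realType) (E : finType) (plus : E) (d : nat).
Local Notation Omega := (config plus d).
Implicit Types (g : specification R plus d) (L : {fset lattice d}).
Implicit Types (mu nu : probability Omega R).

Definition kern_prob g L (s w : Omega) : \bar R :=
  g L w (cylinder (restr L s)).

(* The empty volume has to be left out: its kernel gives probability 1 to the
   only restriction. *)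
Definition non_null g : Prop :=
  forall L, L != fset0 -> exists a b : R,
    [/\ (0 < a)%R, (a < b)%R & (b < 1)%R] /\
    (a%:E < ereal_inf (range (fun p : Omega * Omega => kern_prob g L p.1 p.2))
     /\
     ereal_sup (range (fun p : Omega * Omega => kern_prob g L p.1 p.2)) < b%:E).

Definition spec_invariant g : Prop :=
  forall L (x : lattice d) (A : set Omega) (w : Omega), measurable A ->
    g (fset_translate L x) w A = g L (translate x w) (translate x @` A).

Definition translation_invariant mu : Prop :=
  forall (x : lattice d) (A : set Omega), measurable A ->
    mu (translate x @^-1` A) = mu A.

(* f is a version of the conditional probability of A given the coordinates
   in S. *)
Definition is_cond_prob mu (S : set (lattice d)) (A : set Omega)
    (f : Omega -> \bar R) : Prop :=
  measurable_fun [set: config_on plus S] f /\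
  forall B, sigma_coord S B -> \int[mu]_(w in B) f w = mu (A `&` B).

Definition gibbs g mu : Prop :=
  forall L (A : set Omega), measurable A ->
    is_cond_prob mu (off L) A (fun w => g L w A).

Definition continuity_set g : set Omega :=
  [set w | forall L (f : Omega -> R), local_fun f ->
    {for w, continuous (fun v : Omega => (\int[g L v]_x f x)%R)}].

Definition past_continuity_set g : set Omega :=
  [set s | continuity_set g (plus_future s)].

Definition volume (n : nat) : \bar R := (#|` box d n|%:R)%:E.

Definition plus_prob mu (n : nat) : \bar R :=
  mu (cylinder (restr (box d n) (all_plus plus))).

(* Logarithms and limits are taken in \bar R: lne 0 = -oo and 0 * x = 0 for
   every x, so that a null cylinder contributes 0 to the entropies. A limit
   (limn) is meaningful only under the matching convergence (cvgn); the
   existence of the one in [entropy] for invariant mu is a classical result. *)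
Definition log_plus_density nu (n : nat) : \bar R :=
  (volume n)^-1 * lne (plus_prob nu n).

Definition has_eplus nu : Prop := cvgn (log_plus_density nu).

Definition eplus nu : \bar R := - limn (log_plus_density nu).

Definition entropy mu : \bar R :=
  - limn (fun n => (volume n)^-1 *
      \sum_(s : {ffun box d n -> E}) mu (cylinder s) * lne (mu (cylinder s))).

Definition marginal_dominates nu mu L : Prop :=
  forall B : set {ffun L -> E},
    nu [set w | B (restr L w)] = 0 -> mu [set w | B (restr L w)] = 0.

Definition relative_entropy_in L mu nu : \bar R :=
  if `[< marginal_dominates nu mu L >] then
    \sum_(s : {ffun L -> E})
      mu (cylinder s) * lne (mu (cylinder s) / nu (cylinder s))
  else +oo.

Definition relative_entropy_density mu nu (n : nat) : \bar R :=
  (volume n)^-1 * relative_entropy_in (box d n) mu nu.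

Definition has_relative_entropy mu nu : Prop :=
  cvgn (relative_entropy_density mu nu).

Definition relative_entropy mu nu : \bar R :=
  limn (relative_entropy_density mu nu).

End specifications.

(* Main.v *)
Require Import Defs.
From HB Require Import structures.
From mathcomp Require Import all_boot all_order all_algebra finmap.
From mathcomp Require Import all_classical all_reals all_analysis.
From mathcomp Require Import measurable_realfun.
From mathcomp Require Import zify ring lra.

Set Implicit Arguments.
Unset Strict Implicit.
Unset Printing Implicit Defensive.

Import Order.TTheory GRing.Theory Num.Theory.
Import numFieldNormedType.Exports.

Local Open Scope classical_set_scope.
Local Open Scope ring_scope.
Local Open Scope ereal_scope.

(** Write P_V(s) for the nu-probability of the cylinder of s over a finite set
    V, Q_V(s) for the mu-probability, and L for the box of size n. All cylinders
    are nu-charged, so that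
      h_L(mu|nu) = int ln Q_L dmu
                   - int (ln P_L(s) - ln P_L(+)) mu(ds) - ln P_L(+).
    After division by |L| the first two terms converge to finite limits. Hence
    the relative entropy density and the density -(1/|L|) ln P_L(+) converge
    together, whether or not the limit is finite, and the formula follows.

    The second term is treated by turning the spins of s into + one at a time,
    in decreasing lexicographic order ([telescope_fset]). Changing the spin at
    x contributes the logarithm of a ratio of two nu-conditional probabilities
    of the spin at x given the rest of L, in a configuration equal to s before
    x and to + after x. By invariance this is the same function [log_ratio] of
    the translated box L - x and of the translated configuration, and
    integrating against the invariant mu leaves the average over x of a
    function of L - x ([integral_log_likelihood]). As nu is Gibbs, the
    conditional probability is the mean of the kernel at the origin over a
    cylinder ([gibbs_cyl_prob]); it tends to the kernel itself wherever the
    kernel is continuous, that is mu-almost surely, and it is bounded away from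
    zero by non-nullness. Dominated convergence along growing finite sets
    ([integral_log_ratio_cvg]) and a Cesaro argument ([cesaro_box]: all but a
    vanishing fraction of the sites x of L see a large box around them inside L)
    give the limit int ln (gamma_0(s+|s+) / gamma_0(+|s+)) mu(ds).

    The first term is minus the entropy. The same telescoping writes it as the
    average over x of minus the conditional entropy of the spin at x given the
    part of L that precedes x. Conditioning lowers entropy
    ([mean_log_incr_mono]), so these terms are monotone in the translated box
    and converge, and the same Cesaro argument applies ([mean_log_cvg]).

    When mu is Gibbs too, the argument for the second term applies to the pair
    (mu, mu) and yields the same limit, because that limit only involves the
    kernel. Subtracting it, h_L(mu|nu) and ln (Q_L(+) / P_L(+)) differ by
    o(|L|).

    The hypothesis on mu speaks of a set that has to be shown measurable before
    anything can be deduced almost surely: the continuity points of a real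
    function form a G_delta set, and by finiteness of the spin space countably
    many functions suffice ([continuity_setE]). *)

(** * Telescoping along a total order *)

Section lattice_order.
Variable d : nat.
Implicit Types x y z : lattice d.

Lemma lex_coords_inj : injective (@lex_coords d).
Proof.
move=> x y xy; apply/rowP => i.
by have := congr1 (fun t => tnth t i) xy; rewrite !tnth_mktuple.
Qed.

Lemma lex_le_refl : reflexive (@lex_le d).
Proof. by move=> x; exact: lexx. Qed.

Lemma lex_le_anti : antisymmetric (@lex_le d).
Proof. by move=> x y; rewrite /lex_le => /le_anti/lex_coords_inj. Qed.

Lemma lex_le_trans : transitive (@lex_le d).
Proof. by move=> x y z; exact: le_trans. Qed.

Lemma lex_le_total : total (@lex_le d).
Proof. by move=> x y; exact: le_total. Qed.

Lemma lex_le_translate z x y : lex_le (z + x)%R (z + y)%R = lex_le x y.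
Proof.
by apply/lexi_tupleP/lexi_tupleP => -[k kP]; exists k => i ik; have := kP i ik;
  rewrite !tnth_mktuple !mxE /Order.leif lerD2l (inj_eq (addrI _)).
Qed.

Lemma lex_le_sub x y : lex_le y x = lex_le (y - x)%R 0%R.
Proof. by rewrite -(lex_le_translate (- x)%R) addNr addrC. Qed.

End lattice_order.

Section telescope.
Variables (T : choiceType) (r : rel T).
Hypotheses (r_refl : reflexive r) (r_anti : antisymmetric r)
  (r_trans : transitive r) (r_total : total r).

Lemma fset_max (D : {fset T}) :
  D != fset0 -> exists2 m, m \in D & forall y, y \in D -> r y m.
Proof.
elim/finSet_rect: D => D IH /fset0Pn[a aD].
have [D0|Da] := eqVneq (D `\ a)%fset fset0.
  exists a => // y yD; have [->//|ya] := eqVneq y a.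
  by have := in_fset0 y; rewrite -D0 !inE ya yD.
have [m] := IH _ (fproperD1 aD) Da.
rewrite !inE => /andP[ma mD] mP.
have [am|/negbTE nam] := boolP (r a m).
  exists m => // y yD; have [->//|ya] := eqVneq y a.
  by apply: mP; rewrite !inE ya yD.
have ram : r m a by have := r_total m a; rewrite nam orbF.
exists a => // y yD; have [->//|ya] := eqVneq y a.
by apply: (r_trans _ ram); apply: mP; rewrite !inE ya yD.
Qed.

(** Summing over D in increasing order, the terms cancel in pairs: the part of D
    strictly below x is the part up to the predecessor of x. The induction
    removes the largest element. *)
Lemma telescope_fset (V : zmodType) (phi : {fset T} -> V) (D : {fset T}) :
  (\sum_(x <- D) (phi [fset y in D | r y x]%fset
                 - phi [fset y in D | r y x && (y != x)]%fset)
   = phi D - phi fset0)%R.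
Proof.
elim/finSet_rect: D => D IH.
have [->|D0] := eqVneq D fset0; first by rewrite big_seq_fset0 subrr.
have [m mD mP] := fset_max D0.
rewrite (big_fsetD1 m) //=.
have -> : [fset y in D | r y m]%fset = D.
  apply/fsetP => y; rewrite !inE /=; apply: andb_idr => yD; exact: mP.
have -> : [fset y in D | r y m && (y != m)]%fset = (D `\ m)%fset.
  apply/fsetP => y; rewrite !inE /=; rewrite andbC.
  by have [/mP ->|] := boolP (y \in D); rewrite ?andbF ?andbT.
rewrite -[RHS](subrKA (phi (D `\ m)%fset)); congr (_ + _)%R.
rewrite -IH ?fproperD1 // [LHS]big_seq [RHS]big_seq; apply: eq_bigr => x.
rewrite !inE => /andP[xm xD].
have ymN y : r y x -> y != m.
  move=> ryx; apply: contraNneq xm => ym; apply/eqP/r_anti.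
  by rewrite mP //= -ym.
congr (phi _ - phi _)%R; apply/fsetP => y; rewrite !inE /=;
  by case ryx : (r y x); rewrite ?andbF //= ?andbT ymN.
Qed.

End telescope.

(** * Boxes and Cesaro averages over translates *)

Section boxes.
Variable d : nat.
Implicit Types (x y z : lattice d) (V : {fset lattice d}).

Lemma card_box n : #|` box d n| = (n.*2.+1 ^ d)%N.
Proof.
rewrite /box card_in_imfset /=; last first.
  move=> f h _ _ fh; apply/ffunP => i; apply: val_inj => /=.
  have := congr1 (fun r : lattice d => r ord0 i) fh; rewrite !mxE => /addIr.
  by case.
by rewrite -cardE card_ffun !card_ord.
Qed.

Lemma subset_box m n : (m <= n)%N -> (box d m `<=` box d n)%fset.
Proof.
move=> mn; apply/fsubsetP => x; rewrite !in_box => /forallP xm.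
by apply/forallP => i; exact: leq_trans (xm i) mn.
Qed.

Lemma fset_sub_box V : exists m, (V `<=` box d m)%fset.
Proof.
exists (\max_(x <- V) \max_i `|x ord0 i|%N)%N; apply/fsubsetP => x xV.
rewrite in_box; apply/forallP => i.
apply: leq_trans (leq_bigmax_seq _ xV isT).
exact: (@leq_bigmax _ (fun i => `|x ord0 i|%N)).
Qed.

Lemma in_fset_translate V x y : (y \in fset_translate V x) = ((y - x)%R \in V).
Proof.
apply/imfsetP/idP => [[z zV ->]|yV]; first by rewrite addrK.
by exists (y - x)%R; rewrite ?subrK.
Qed.

Lemma translate_sup_box m n x : (m <= n)%N -> x \in box d (n - m) ->
  (box d m `<=` fset_translate (box d n) (- x)%R)%fset.
Proof.
move=> mn; rewrite in_box => /forallP xn; apply/fsubsetP => y.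
rewrite in_fset_translate opprK !in_box => /forallP ym.
apply/forallP => i; rewrite mxE; have := xn i; have := ym i.
by move: (x ord0 i) (y ord0 i) => a b; lia.
Qed.

End boxes.

Section cesaro.
Variables (R : realType) (d : nat).
Implicit Types (Phi : {fset lattice d} -> R).
Local Open Scope ring_scope.

Lemma cvg_card_box_ratio m :
  (fun n => (#|` box d (n - m)|)%:R / (#|` box d n|)%:R : R) @ \oo --> (1 : R).
Proof.
pose u n : R := (n.*2.+1)%:R^-1.
have u0 : u n @[n --> \oo] --> (0 : R).
  apply: (@squeeze_cvgr _ _ _ _ (fun=> 0) harmonic);
    [|exact: cvg_cst|exact: cvg_harmonic].
  near=> n; rewrite /u invr_ge0 ler0n /= lef_pV2 ?posrE ?ltr0n// ler_nat.
  by rewrite ltnS -addnn leq_addr.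
have : (1 - (m.*2)%:R * u n) ^+ d @[n --> \oo] --> (1 : R).
  have h : 1 - (m.*2)%:R * u n @[n --> \oo] --> (1 - (m.*2)%:R * 0 : R).
    by apply: cvgB; [exact: cvg_cst|apply: cvgM => //; exact: cvg_cst].
  have := cvg_comp _ _ h (@exprn_continuous R d _).
  by rewrite mulr0 subr0 expr1n.
apply: cvg_trans; apply: near_eq_cvg; near=> n.
have mn : (m <= n)%N by near: n; exists m.
rewrite !card_box !natrX -expr_div_n; congr (_ ^+ _).
have -> : (n.*2.+1)%:R = ((n - m).*2.+1)%:R + (m.*2)%:R :> R.
  by rewrite -natrD; congr (_%:R); lia.
rewrite /u; have -> : (n.*2.+1)%:R = ((n - m).*2.+1)%:R + (m.*2)%:R :> R.
  by rewrite -natrD; congr (_%:R); lia.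
have : ((n - m).*2.+1)%:R + (m.*2)%:R != 0 :> R.
  by rewrite -natrD pnatr_eq0.
move=> ?; by field.
Unshelve. all: by end_near. Qed.

(** The net convergence of Phi is along sets that contain a large box. For x at
    distance at least m from the boundary of the box of size n, the translate
    contains the box of size m, so the term of x is close to l; the other terms
    are bounded and their proportion vanishes. *)
Lemma cesaro_box Phi (l C : R) :
  (forall V, `|Phi V| <= C) ->
  (forall e, 0 < e ->
    exists m, forall V, (box d m `<=` V)%fset -> `|Phi V - l| <= e) ->
  (fun n => (#|` box d n|)%:R^-1 *
    \sum_(x <- box d n) Phi (fset_translate (box d n) (- x))) @ \oo --> l.
Proof.
move=> PhiC Phil; apply/cvgrPdist_le => e e0.
have [m mP] := Phil _ (divr_gt0 e0 (ltr0n R 2)).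
pose K := C + `|l|.
have K0 : 0 <= K by rewrite addr_ge0// (le_trans _ (PhiC fset0)).
have e1 : 0 < e / 2 / (K + 1) by rewrite !divr_gt0// ltr_wpDl.
have /cvgrPdist_le/(_ _ e1) := cvg_card_box_ratio m.
apply: filter_app; near=> n.
have mn : (m <= n)%N by near: n; exists m.
set N := (#|` box d n|)%:R : R; set N' := (#|` box d (n - m)|)%:R : R.
have N0 : 0 < N by rewrite ltr0n card_box expn_gt0.
move=> ratio.
have -> : l = N^-1 * \sum_(x <- box d n) l.
  by rewrite big_const_seq count_predT iter_addr_0 -mulr_natl mulrA mulVf
    ?mul1r ?gt_eqF.
rewrite -mulrBr -sumrB normrM gtr0_norm ?invr_gt0//.
rewrite ler_pdivrMl// (le_trans (ler_norm_sum _ _ _))//.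
(* Sites near the boundary cost at most K, the others e / 2. *)
rewrite (@le_trans _ _ (\sum_(x <- box d n)
    (e / 2 + K * (1 - (x \in box d (n - m))%:R))))//.
  apply: ler_sum => x _; rewrite distrC; case: (boolP (x \in _)) => xb.
    by rewrite subrr mulr0 addr0; apply: mP; exact: translate_sup_box.
  rewrite subr0 mulr1 (le_trans (ler_normB _ _))//.
  by rewrite (le_trans (lerD (PhiC _) (lexx _)))// lerDr divr_ge0// ltW.
rewrite big_split/= -[X in _ + X]mulr_sumr sumrB/=.
have sumc c : \sum_(x <- box d n) c = N * c :> R.
  by rewrite big_const_seq count_predT iter_addr_0 -mulr_natl.
rewrite !sumc.
have -> : \sum_(x <- box d n) (x \in box d (n - m))%:R = N'.
  have -> : \sum_(x <- box d n) (x \in box d (n - m))%:R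
      = (count [in box d (n - m)] (box d n))%:R :> R.
    rewrite -natr_sum -sum1_count [in RHS]big_mkcond /=.
    by congr (_%:R); apply: eq_bigr => x _; case: ifP.
  rewrite -size_filter /N'; congr (_%:R); apply: perm_size; apply: uniq_perm.
  - by rewrite filter_uniq.
  - by [].
  - move=> x; rewrite mem_filter; apply: andb_idr => /=.
    by apply/fsubsetP/subset_box/leq_subr.
have NN' : N - N' <= N * (e / 2 / (K + 1)).
  have := le_trans (ler_norm _) ratio.
  by rewrite -(ler_pM2l N0) mulrBr mulr1 mulrCA mulfV ?mulr1// gt_eqF.
rewrite mulr1 [leRHS](_ : _ = N * (e / 2) + N * (e / 2)); last by field.
rewrite lerD2l (le_trans (ler_wpM2l K0 NN'))// mulrCA ler_pM2l//.
rewrite mulrCA ler_piMr ?divr_ge0 ?(ltW e0)//.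
by rewrite ler_pdivrMr ?mul1r ?lerDl ?ltr_wpDl.
Unshelve. all: by end_near. Qed.
End cesaro.

(** * Topology and measurability of configurations *)

Section configuration_space.
Variables (E : finType) (plus : E) (d : nat).
Local Notation Omega := (config plus d).
Implicit Types (w v : Omega) (x y : lattice d) (V L D : {fset lattice d}).

Lemma cvg_config (F : set_system Omega) w : Filter F ->
  (forall x, \forall v \near F, v x = w x) -> F --> w.
Proof.
move=> FF h; apply/cvg_sup => x U [V [[W] oW <-]] Ww WU.
apply: (filterS WU); apply: filterS (h x) => v /= vw.
by move: Ww; rewrite /= vw.
Qed.

Lemma near_coord w x : \forall v \near w, v x = w x.
Proof.
have := @proj_continuous _ (fun=> discrete_topology E) x w.
by move=> /(_ [set w x]); apply; rewrite nbhs_principalE; apply/principal_filterP.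
Qed.

Lemma open_coord x (B : set E) : open [set w : Omega | B (w x)].
Proof.
rewrite openE => w /= Bw; apply: filterS (near_coord w x) => v /= vw.
by rewrite /= vw.
Qed.

Lemma open_config_measurable (A : set Omega) : open A -> measurable A.
Proof. by move=> oA; apply: (@sub_sigma_algebra _ setT (@open Omega)). Qed.

Lemma coord_measurable x (B : set E) : measurable [set w : Omega | B (w x)].
Proof. apply: open_config_measurable. exact: open_coord. Qed.

Lemma sigma_coord_measurable (S : set (lattice d)) (A : set Omega) :
  sigma_coord S A -> measurable A.
Proof.
apply: smallest_sub; first exact: sigma_algebra_measurable.
by move=> _ [x _ [B ->]]; exact: coord_measurable.
Qed.

Lemma measurable_config_on d' (T : measurableType d') (S : set (lattice d))
    (f : Omega -> T) :
  measurable_fun [set: config_on plus S] f -> measurable_fun [set: Omega] f.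
Proof.
move=> mf _ B mB; rewrite setTI; have := mf measurableT B mB; rewrite setTI.
exact: sigma_coord_measurable.
Qed.

Lemma continuous_measurable_config (f : Omega -> Omega) :
  continuous f -> measurable_fun [set: Omega] f.
Proof.
move=> cf; apply: (@measurability _ _ _ _ _ _ (@open Omega)) => //.
move=> _ [A oA <-]; rewrite setTI; apply: open_config_measurable.
by apply: open_comp => // w _; exact: cf.
Qed.

Definition agree (S : set (lattice d)) w v := forall x, S x -> w x = v x.

(** The sets that do not separate w from v form a sigma-algebra containing the
    generators. *)
Lemma sigma_coord_agree (S : set (lattice d)) (A : set Omega) w v :
  sigma_coord S A -> agree S w v -> A w -> A v.
Proof.
move=> SA wv; suff : A w <-> A v by case.
move: SA; apply: (@smallest_sub _ _ _ [set A | A w <-> A v]).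
  split=> /= [//|B Bwv|F Fwv].
    by rewrite /setD /= /setT; split=> -[_ nB]; split=> // /Bwv.
  by split=> -[n _ Fn]; exists n => //; exact/Fwv.
move=> _ [x Sx [B ->]] /=; by rewrite wv.
Qed.

(** Applied to a kernel, whose measurability refers to the coordinates off its
    volume, this frees it from the spins inside the volume. *)
Lemma config_on_agree d' (T : measurableType d') (S : set (lattice d))
    (f : Omega -> T) w v :
  (forall t : T, measurable [set t]) ->
  measurable_fun [set: config_on plus S] f -> agree S w v -> f w = f v.
Proof.
move=> m1 mf wv; apply/esym.
have := mf measurableT [set f w] (m1 _); rewrite setTI => /sigma_coord_agree.
by move=> /(_ _ _ wv); apply.
Qed.

Lemma continuous_config (f : Omega -> Omega) :
  (forall w x, \forall v \near w, f v x = f w x) -> continuous f.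
Proof.
move=> h w; have FF : Filter (f @ w) by exact (fmap_filter f (nbhs_filter w)).
have X := cvg_config (w := f w) FF (h w).
exact: X.
Qed.

Lemma translate_continuous x : continuous (translate x : Omega -> Omega).
Proof. by apply: continuous_config => w y; exact: (near_coord w (x + y)%R). Qed.

Lemma plus_future_continuous : continuous (@plus_future E plus d).
Proof.
apply: continuous_config => w y; rewrite /plus_future.
by case: ifP => _; [exact: near_coord|exact: filterE].
Qed.

Definition set_spin (e : E) w : Omega := fun y => if y == 0%R then e else w y.

End configuration_space.

Arguments set_spin {E plus d}.

(** * Local functions *)

Section local_functions.
Variables (R : realType) (E : finType) (plus : E) (d : nat).
Local Notation Omega := (config plus d).
Implicit Types (w v : Omega) (x y : lattice d) (V L D : {fset lattice d}).

(** A section of the restriction map; it turns integrals of local functions into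
    sums over the finite set of local configurations. *)
Definition extend D (s : {ffun D -> E}) : Omega :=
  fun x => if insub x is Some y then s y else plus.

Lemma restr_extend D (s : {ffun D -> E}) : restr D (extend s) = s.
Proof. by apply/ffunP => x; rewrite ffunE /extend valK. Qed.

Lemma restrP D w v : restr D w = restr D v <-> agree [set` D] w v.
Proof.
split=> [wv x xD|wv]; last by apply/ffunP => x; rewrite !ffunE wv //=; exact: valP.
by have := congr1 (fun s : {ffun D -> E} => s [` xD]%fset) wv; rewrite !ffunE.
Qed.

Lemma agree_extend D w : agree [set` D] (extend (restr D w)) w.
Proof. by apply/restrP; rewrite restr_extend. Qed.

Lemma cylinderE D w : cylinder (restr D w) = [set v | agree [set` D] v w].
Proof. by apply/seteqP; split=> v /restrP. Qed.

Lemma cylinder_config_on (S : set (lattice d)) D (s : {ffun D -> E}) :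
  [set` D] `<=` S -> measurable (cylinder s : set (config_on plus S)).
Proof.
move=> DS.
have -> : cylinder s = \bigcap_(x in [set: D]) [set w : Omega | w (val x) = s x].
  apply/seteqP; split=> w /= => [ws x _|ws]; first by rewrite -ws ffunE.
  by apply/ffunP => x; rewrite ffunE; exact: ws.
apply: fin_bigcap_measurable; first exact: finite_finset.
move=> x _; apply: sub_sigma_algebra; exists (val x); first exact/DS/valP.
by exists [set s x].
Qed.

Lemma cylinder_measurable D (s : {ffun D -> E}) :
  measurable (cylinder s : set Omega).
Proof.
have /sigma_coord_measurable : sigma_coord [set` D] (@cylinder E plus d D s).
  exact: cylinder_config_on.
by [].
Qed.

Definition local_on D (T : Type) (G : Omega -> T) :=
  forall w v, agree [set` D] w v -> G w = G v.

Lemma local_on_extend D T (G : Omega -> T) w :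
  local_on D G -> G (extend (restr D w)) = G w.
Proof. by move=> lG; apply: lG; exact: agree_extend. Qed.

Lemma local_config_on D d' (T : measurableType d') (G : Omega -> T) :
  local_on D G -> measurable_fun [set: config_on plus [set` D]] G.
Proof.
move=> lG _ B mB; rewrite setTI.
have -> : G @^-1` B = \bigcup_(s in [set s : {ffun D -> E} | B (G (extend s))])
    cylinder s.
  apply/seteqP; split=> w /=.
    by move=> BGw; exists (restr D w) => //=; rewrite local_on_extend.
  by move=> [s /= BGs] ws; rewrite -(local_on_extend w lG) ws.
apply: fin_bigcup_measurable; first exact: finite_finset.
by move=> s _; exact: cylinder_config_on.
Qed.

Lemma local_measurable D d' (T : measurableType d') (G : Omega -> T) :
  local_on D G -> measurable_fun [set: Omega] G.
Proof. by move=> /local_config_on/measurable_config_on. Qed.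

Lemma local_onE D (G : Omega -> R) w : local_on D G ->
  G w = (\sum_(s : {ffun D -> E}) G (extend s) * \1_(cylinder s) w)%R.
Proof.
move=> lG; rewrite (bigD1 (restr D w)) //= big1 ?addr0; last first.
  move=> s /eqP sw; rewrite indicE memNset ?mulr0 //= => ws.
  exact: sw.
by rewrite indicE mem_set ?mulr1 // local_on_extend.
Qed.

Variable P : {measure set Omega -> \bar R}.
Hypothesis P1 : P [set: Omega] = 1.

Lemma proba_fin_num (A : set Omega) : measurable A -> P A \is a fin_num.
Proof.
move=> mA; rewrite ge0_fin_numE //; apply: (@le_lt_trans _ _ 1); last exact: ltry.
by rewrite -P1; apply: le_measure; rewrite ?inE.
Qed.

Lemma bounded_integrable (f : Omega -> R) (C : R) :
  measurable_fun setT f -> (forall w, `|f w| <= C)%R ->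
  P.-integrable setT (EFin \o f).
Proof.
move=> mf fC; apply: measurable_bounded_integrable => //.
  by rewrite P1; exact: ltry.
exists C; split; first exact: num_real.
by move=> M CM w _ /=; rewrite (le_trans (fC w)) // ltW.
Qed.

Lemma local_integrable D (G : Omega -> R) : local_on D G ->
  P.-integrable setT (EFin \o G).
Proof.
move=> lG; apply: (@bounded_integrable _
    (\sum_(s : {ffun D -> E}) `|G (extend s)|)%R).
  exact: local_measurable lG.
move=> w; rewrite -(local_on_extend w lG).
by rewrite (bigD1 (restr D w)) //= lerDl sumr_ge0.
Qed.

Lemma local_integral_in D (G : Omega -> R) (A : set Omega) :
  measurable A -> local_on D G ->
  \int[P]_(w in A) (G w)%:E =
  \sum_(s : {ffun D -> E}) (G (extend s))%:E * P (A `&` cylinder s).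
Proof.
move=> mA lG.
transitivity (\int[P]_(w in A) \sum_(s : {ffun D -> E})
    ((G (extend s))%:E * (\1_(cylinder s) w)%:E)).
  apply: eq_integral => w _; rewrite (local_onE w lG) -sumEFin.
  by apply: eq_bigr => s _; rewrite EFinM.
have ii (s : {ffun D -> E}) :
    P.-integrable A (fun w => (\1_(cylinder s) w)%:E).
  apply: (@integrableS _ _ _ _ setT) => //.
  apply: (@bounded_integrable (\1_(cylinder s)) 1).
    by apply: measurable_indic; exact: cylinder_measurable.
  by move=> w; rewrite indicE; case: (_ \in _); rewrite ?normr1 ?normr0.
rewrite integral_sum //; last by move=> s; exact: integrableZl.
apply: eq_bigr => s _; rewrite integralZl // integral_indic //; last first.
  exact: cylinder_measurable.
by rewrite setIC.
Qed.

Lemma local_integral D (G : Omega -> R) : local_on D G ->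
  \int[P]_w (G w)%:E =
  \sum_(s : {ffun D -> E}) (G (extend s))%:E * P (cylinder s).
Proof.
by move=> lG; rewrite (local_integral_in _ lG) //; under eq_bigr do rewrite setTI.
Qed.

End local_functions.

Arguments extend {E plus d D} s.

(** * Measurability of the set of continuity points *)

Lemma cvg_lin_comb (R : realType) (T I : Type) (F : set_system T) (r : seq I)
    (c : I -> R) (f : I -> T -> R) (l : I -> R) : Filter F ->
  (forall i, f i @ F --> l i) ->
  ((fun x => \sum_(i <- r) c i * f i x) @ F --> \sum_(i <- r) c i * l i)%R.
Proof.
move=> FF fl; elim: r => [|i r IH].
  by rewrite big_nil; under eq_fun do rewrite big_nil; exact: cvg_cst.
rewrite big_cons; under eq_fun do rewrite big_cons.
by apply: cvgD => //; apply: cvgM => //; exact: cvg_cst.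
Qed.

Section continuity_points.
Variables (R : realType) (E : finType) (plus : E) (d : nat).
Local Notation Omega := (config plus d).
Implicit Types (w v : Omega) (x y : lattice d) (V L D : {fset lattice d}).

(** Continuity at w says that for every k some open neighbourhood of w has
    oscillation at most 1/k, an open condition on w. *)
Lemma continuity_points_Gdelta (T : topologicalType) (h : T -> R) :
  [set w : T | {for w, continuous h}] =
  \bigcap_(k in [set: nat]) \bigcup_(U in [set U : set T | open U /\
     forall u v : T, U u -> U v -> (`|h u - h v| <= k.+1%:R^-1)%R]) U.
Proof.
apply/seteqP; split => [w /= hw k _|w hw /=].
  have /cvgrPdist_lt/(_ (k.+1%:R^-1 / 2)%R) := hw.
  rewrite divr_gt0 // ?invr_gt0 // => /(_ isT).
  rewrite nbhsE => -[U [oU Uw] Uh]; exists U => //=; split=> // u v.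
  move=> /Uh /= hu /Uh /= hv; rewrite -(subrKA (h w)).
  rewrite (le_trans (ler_normD _ _)) // distrC.
  by rewrite (@splitr _ (k.+1%:R^-1)%R) lerD // ltW.
apply/cvgrPdist_le => e e0.
have [k ke] : exists k, (k.+1%:R^-1 < e)%R.
  have [k _ ke] := near_infty_natSinv_lt (PosNum e0).
  by exists k; apply: ke => /=.
have [U /= [oU Uh] Uw] := hw k I.
have : nbhs w U by apply: open_nbhs_nbhs.
by apply: filterS => v Uv; rewrite (le_trans (Uh _ _ _ _) (ltW ke)).
Qed.

Lemma continuity_points_measurable (h : Omega -> R) :
  measurable [set w : Omega | {for w, continuous h}].
Proof.
rewrite continuity_points_Gdelta; apply: bigcapT_measurable => k.
by apply: open_config_measurable; apply: bigcup_open => U [].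
Qed.

Lemma countable_bigcap_measurable (J : countType) (F : J -> set Omega) :
  (forall i, measurable (F i)) -> measurable (\bigcap_i F i).
Proof.
move=> mF; have -> : \bigcap_i F i =
    \bigcap_n (if choice.unpickle n is Some i then F i else setT).
  apply/seteqP; split=> w Fw => [n _|i _].
    by case: choice.unpickle => // i; exact: Fw.
  by have := Fw (choice.pickle i) I; rewrite choice.pickleK.
by apply: bigcapT_measurable => n; case: choice.unpickle.
Qed.

Variable g : specification R plus d.

Lemma Rintegral_kern_local L D (f : Omega -> R) w : local_on D f ->
  (\int[g L w]_x f x =
   \sum_(s : {ffun D -> E}) f (extend s) * fine (g L w (cylinder s)))%R.
Proof.
move=> lf; have g1 : g L w [set: Omega] = 1 by exact: prob_kernel.
have -> : (\int[g L w]_x f x)%R = fine (\int[g L w]_x (f x)%:E) by [].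
rewrite (local_integral g1 lf) -sum_fine.
  by apply: eq_bigr => s _; rewrite fineM //; apply: (proba_fin_num g1);
    exact: cylinder_measurable.
move=> s _; rewrite fin_numM //; apply: (proba_fin_num g1).
exact: cylinder_measurable.
Qed.

(** A local function is a linear combination of indicators of cylinders over its
    support, so the continuity of all kernels on all local functions reduces to
    countably many functions. *)
Lemma continuity_setE : continuity_set g =
  \bigcap_(p : {fset lattice d} * {fset lattice d})
  \bigcap_(s in [set: {ffun p.2 -> E}])
    [set w | {for w, continuous (fun v => fine (g p.1 v (cylinder s)))}].
Proof.
apply/seteqP; split => w /= gw.
  move=> [L D] _ s _ /=.
  have ls : local_on D (\1_(cylinder s) : Omega -> R).
    move=> u v /restrP uv; rewrite !indicE; congr (_%:R).
    by congr nat_of_bool; apply/idP/idP => /set_mem us; apply/mem_set;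
      move: us; rewrite /cylinder /= uv.
  have := gw L _ (ex_intro _ D (local_config_on ls)).
  congr (continuous_at _ _); apply/funext => v.
  have -> : (\int[g L v]_x \1_(cylinder s) x)%R =
    fine (\int[g L v]_x (\1_(cylinder s) x)%:E) by [].
  by rewrite integral_indic ?setIT //; exact: cylinder_measurable.
move=> L f [D mf].
have lf : local_on D f by move=> u v; apply: config_on_agree mf => t; exact: measurable_set1.
have -> : (fun v : Omega => (\int[g L v]_x f x)%R) =
    (fun v => \sum_(s : {ffun D -> E}) f (extend s) * fine (g L v (cylinder s)))%R.
  by apply/funext => v; rewrite (Rintegral_kern_local _ _ lf).
exact (@cvg_lin_comb R Omega _ (nbhs w) (index_enum _)
  (fun s : {ffun D -> E} => f (extend s))
  (fun s v => fine (g L v (cylinder s))) (fun s => fine (g L w (cylinder s)))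
  (nbhs_filter w) (fun s => gw (L, D) I s I)).
Qed.

Lemma continuity_set_measurable : measurable (continuity_set g).
Proof.
rewrite continuity_setE; apply: countable_bigcap_measurable => -[L D].
apply: fin_bigcap_measurable; first exact: finite_finset.
by move=> s _; exact: continuity_points_measurable.
Qed.

(** Without this, the value that a measure gives to the set carries no
    information about null sets. *)
Lemma past_continuity_set_measurable : measurable (past_continuity_set g).
Proof.
rewrite -[X in measurable X]setTI.
apply: (continuous_measurable_config (@plus_future_continuous E plus d)) => //.
exact: continuity_set_measurable.
Qed.

End continuity_points.

(** * Cylinder probabilities and Gibbs kernels at the origin *)

Section cylinder_probabilities.
Variables (R : realType) (E : finType) (plus : E) (d : nat).
Local Notation Omega := (config plus d).
Implicit Types (w v : Omega) (x y : lattice d) (V W L D : {fset lattice d}).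
Implicit Type mu : probability Omega R.

Lemma spin_measurable e : measurable [set v : Omega | v 0%R = e].
Proof. exact (coord_measurable 0%R [set e]). Qed.

Definition cyl_prob mu V w : R := fine (mu (cylinder (restr V w))).

Lemma cyl_probE mu V w : mu (cylinder (restr V w)) = (cyl_prob mu V w)%:E.
Proof. by rewrite fineK // fin_num_measure //; exact: cylinder_measurable. Qed.

Lemma cyl_prob_ge0 mu V w : (0 <= cyl_prob mu V w)%R.
Proof. by rewrite fine_ge0. Qed.

Lemma cyl_prob0 mu w : cyl_prob mu fset0 w = 1%R.
Proof.
rewrite /cyl_prob cylinderE (_ : [set v | _] = setT) ?probability_setT //.
by apply/seteqP; split=> // v _ x /=; rewrite inE.
Qed.

Lemma cyl_prob_mono mu V W w : (V `<=` W)%fset ->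
  (cyl_prob mu W w <= cyl_prob mu V w)%R.
Proof.
move=> /fsubsetP VW; rewrite -lee_fin -!cyl_probE; apply: le_measure.
- by rewrite inE; exact: cylinder_measurable.
- by rewrite inE; exact: cylinder_measurable.
by rewrite !cylinderE => v vw x xV; apply: vw; exact: VW.
Qed.

Lemma cyl_prob_agree mu V w v : agree [set` V] w v ->
  cyl_prob mu V w = cyl_prob mu V v.
Proof. by move=> /restrP wv; rewrite /cyl_prob wv. Qed.

Lemma cyl_prob_local mu V : local_on V (cyl_prob mu V).
Proof. by move=> w v; exact: cyl_prob_agree. Qed.

Lemma cyl_prob_translate mu V x w : translation_invariant mu ->
  cyl_prob mu (fset_translate V (- x)%R) (translate x w) = cyl_prob mu V w.
Proof.
move=> mu_inv; rewrite /cyl_prob -(mu_inv x); last exact: cylinder_measurable.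
congr (fine (mu _)); rewrite !cylinderE; apply/seteqP; split=> v vw y /=.
  move=> yV; have := vw (y - x)%R; rewrite /= in_fset_translate opprK subrK.
  by move=> /(_ yV); rewrite /translate addrC subrK.
by rewrite in_fset_translate opprK => yV; rewrite /translate addrC; exact: vw.
Qed.

(** The conditional law of the spin at the origin is handled through this
    identity, which keeps every probability in the form [cyl_prob]. *)
Lemma cyl_set_spin W e w : 0%R \notin W ->
  cylinder (restr (0%R |` W)%fset (set_spin e w)) =
  [set v : Omega | v 0%R = e] `&` cylinder (restr W w).
Proof.
move=> W0; rewrite !cylinderE; apply/seteqP; split=> v /=.
  move=> vw; split; first by rewrite vw /= ?fset1U1 // /set_spin eqxx.
  move=> x xW; rewrite vw /=; last by rewrite inE xW orbT.
  by rewrite /set_spin; case: eqP => // x0; move: W0; rewrite -x0 xW.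
move=> [v0 vw] x; rewrite /= !inE /set_spin => /orP[/eqP ->|xW].
  by rewrite eqxx.
by case: eqP => [x0|_]; [move: W0; rewrite -x0 xW|exact: vw].
Qed.

Lemma sum_cyl_prob_spin mu W w : 0%R \notin W ->
  (\sum_e cyl_prob mu (0 |` W)%fset (set_spin e w))%R = cyl_prob mu W w.
Proof.
move=> W0; apply: EFin_inj; rewrite -sumEFin -cyl_probE.
under eq_bigr do rewrite -cyl_probE.
rewrite fsbig_seq ?index_enum_uniq // -measure_fin_bigcup; first last.
- by move=> e _; exact: cylinder_measurable.
- move=> e f _ _ [v []]; rewrite !cyl_set_spin // => -[<- _] [<- _].
  by [].
- exact: finite_finset.
congr (mu _); apply/seteqP; split=> v.
  by move=> [e _]; rewrite cyl_set_spin // => -[].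
by move=> vw; exists (v 0%R); rewrite /= ?mem_index_enum // cyl_set_spin.
Qed.

End cylinder_probabilities.

Section gibbs_bounds.
Variables (R : realType) (E : finType) (plus : E) (d : nat).
Local Notation Omega := (config plus d).
Implicit Types (w v : Omega) (x y : lattice d) (V W L D : {fset lattice d}).
Variables (g : specification R plus d).

Definition spin_kern (e : E) w : R :=
  fine (g [fset 0%R]%fset w [set v : Omega | v 0%R = e]).

Lemma spin_kernE e w :
  g [fset 0%R]%fset w [set v : Omega | v 0%R = e] = (spin_kern e w)%:E.
Proof.
rewrite fineK //; apply: proba_fin_num; first exact: prob_kernel.
exact: spin_measurable.
Qed.

Lemma kern_probE (s w : Omega) :
  kern_prob g [fset 0%R]%fset s w = (spin_kern (s 0%R) w)%:E.
Proof.
rewrite -spin_kernE /kern_prob cylinderE; congr (g _ _ _).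
apply/seteqP; split=> v /= vs; first by apply: vs; rewrite /= inE.
by move=> x /=; rewrite inE => /eqP ->.
Qed.

Lemma spin_kern_config_on e :
  measurable_fun [set: config_on plus (off [fset 0%R]%fset)] (spin_kern e).
Proof.
apply: (@measurableT_comp _ _ _ _ _ _ fine) => //.
apply: measurable_kernel; exact: spin_measurable.
Qed.

Lemma spin_kern_agree e w v : agree (off [fset 0%R]%fset) w v ->
  spin_kern e w = spin_kern e v.
Proof.
apply: config_on_agree (spin_kern_config_on e) => t; exact: measurable_set1.
Qed.

Lemma spin_kern_measurable e : measurable_fun [set: Omega] (spin_kern e).
Proof. exact: measurable_config_on (spin_kern_config_on e). Qed.

(** The lower bound is non-nullness in the volume made of the origin. *)
Lemma spin_kern_bounds : non_null g ->
  exists2 a : R, (0 < a)%R & forall e w, (a <= spin_kern e w <= 1)%R.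
Proof.
move=> /(_ [fset 0%R]%fset) []; first by apply/fset0Pn; exists 0%R; rewrite inE.
move=> a [b [[a0 _ _] [ainf _]]]; exists a => // e w; apply/andP; split.
  rewrite -lee_fin; apply: (le_trans (ltW ainf)).
  apply: ereal_inf_lbound; exists ((fun=> e) : Omega, w) => //=.
  by rewrite kern_probE.
rewrite -lee_fin -spin_kernE -(@prob_kernel _ _ _ _ _ (g [fset 0%R]%fset) w).
apply: le_measure; rewrite ?inE //.
exact: spin_measurable.
Qed.

Variable nu : probability Omega R.
Hypothesis nu_gibbs : gibbs g nu.

(** Conditioning on the spins off the origin replaces the indicator of the spin by
    the kernel. The cylinder over W is such an event as soon as W avoids the
    origin, so bounds of the kernel on it can be integrated. *)
Lemma gibbs_cyl_prob W e w (lo hi : R) : 0%R \notin W -> (0 <= lo)%R ->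
  (forall v, agree [set` W] v w -> (lo <= spin_kern e v <= hi)%R) ->
  (lo * cyl_prob nu W w <= cyl_prob nu (0 |` W)%fset (set_spin e w)
    <= hi * cyl_prob nu W w)%R.
Proof.
move=> W0 lo0 q_bd.
have mW : sigma_coord (off [fset 0%R]%fset) (@cylinder E plus d _ (restr W w)).
  apply: cylinder_config_on => x xW /fset1P x0.
  by move: W0; rewrite -x0 => /negP; apply.
have mC : measurable (cylinder (restr W w) : set Omega).
  exact: cylinder_measurable.
have := (nu_gibbs [fset 0%R]%fset (spin_measurable e)).2 _ mW.
rewrite /= -cyl_set_spin // cyl_probE.
under eq_integral do rewrite spin_kernE.
move=> nuE; rewrite -!lee_fin !EFinM -cyl_probE -nuE.
have mq : measurable_fun (cylinder (restr W w) : set Omega)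
    (fun v => (spin_kern e v)%:E).
  apply/measurable_EFinP; apply: measurable_funS (spin_kern_measurable e) => //.
have bd v : cylinder (restr W w) v -> (lo <= spin_kern e v <= hi)%R.
  by rewrite cylinderE => /q_bd.
rewrite -!(integral_cst nu mC); apply/andP; split; apply: ge0_le_integral => //.
- by move=> v /bd /andP[h _]; rewrite lee_fin.
- by move=> v /bd /andP[h _]; rewrite lee_fin (le_trans lo0).
- by move=> v /bd /andP[_ h]; rewrite lee_fin.
Qed.

End gibbs_bounds.

(** * Conditional distribution of the spin at the origin *)

Section conditional_spin.
Variables (R : realType) (E : finType) (plus : E) (d : nat).
Local Notation Omega := (config plus d).
Implicit Types (w v : Omega) (x y : lattice d) (V W L D : {fset lattice d}).
Implicit Type mu : probability Omega R.
Local Open Scope ring_scope.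

Definition cond_spin mu W (e : E) w : R :=
  cyl_prob mu (0 |` W)%fset (set_spin e w) / cyl_prob mu W w.

Lemma translate0 V x : x \in V ->
  fset_translate V (- x) = (0 |` fset_translate V (- x) `\ 0)%fset.
Proof. by move=> xV; rewrite fsetD1K // in_fset_translate opprK add0r. Qed.

Lemma set_spin_id w : set_spin (w 0) w = w.
Proof. by apply/funext => y; rewrite /set_spin; case: eqP => // ->. Qed.

Lemma local_on_sub (T : Type) D D' (G : Omega -> T) :
  (D `<=` D')%fset -> local_on D G -> local_on D' G.
Proof.
by move=> /fsubsetP DD' lG w v wv; apply: lG => x xD; apply: wv; exact: DD'.
Qed.

Lemma cond_spin_local mu W e : local_on W (cond_spin mu W e).
Proof.
move=> w v wv; rewrite /cond_spin (cyl_prob_local mu wv).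
congr (_ / _); apply: cyl_prob_agree => x; rewrite /= !inE /set_spin.
by case: eqP => //= _ xW; exact: wv.
Qed.

Variables (g : specification R plus d) (nu : probability Omega R).
Hypotheses (g_non_null : non_null g) (nu_gibbs : gibbs g nu)
  (nu_inv : translation_invariant nu).

(** Adding one site to V costs at most a factor a: translate the site to the
    origin and use the lower bound of the kernel. *)
Lemma gibbs_cyl_prob_gt0 V w : 0 < cyl_prob nu V w.
Proof.
have [a a0 qa] := spin_kern_bounds g_non_null.
elim/finSet_rect: V w => V IH w.
have [->|/fset0Pn[x xV]] := eqVneq V fset0; first by rewrite cyl_prob0.
rewrite -(cyl_prob_translate V x w nu_inv) translate0 //.
set W := (_ `\ 0)%fset; have W0 : 0 \notin W by rewrite !inE eqxx.
have WE : W = fset_translate (V `\ x)%fset (- x).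
  apply/fsetP => y; rewrite !inE !in_fset_translate opprK !inE.
  by rewrite -[in RHS]subr_eq0 addrK.
have /andP[+ _] := gibbs_cyl_prob (e := translate x w 0) (w := translate x w)
  nu_gibbs W0 (ltW a0) (fun v _ => qa _ v).
rewrite set_spin_id; apply: lt_le_trans.
rewrite mulr_gt0 // WE cyl_prob_translate //; apply: IH.
exact: fproperD1.
Qed.

Lemma cond_spin_bounds W e w (lo hi : R) : 0 \notin W -> 0 <= lo ->
  (forall v, agree [set` W] v w -> lo <= spin_kern g e v <= hi) ->
  lo <= cond_spin nu W e w <= hi.
Proof.
move=> W0 lo0 /(gibbs_cyl_prob nu_gibbs W0 lo0).
by rewrite ler_pdivlMr ?ler_pdivrMr ?gibbs_cyl_prob_gt0.
Qed.

(** Otherwise configurations equal to w on ever larger boxes, hence converging to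
    w, would violate continuity. *)
Lemma continuous_near_box (h : Omega -> R) w (e : R) :
  {for w, continuous h} -> 0 < e ->
  exists m, forall v, agree [set` box d m] v w -> `|h v - h w| <= e.
Proof.
move=> hw e0; apply: contrapT => /forallNP bad.
have /choice[v vP] : forall m, exists v : Omega,
    agree [set` box d m] v w /\ e < `|h v - h w|.
  move=> m; have /existsNP[v /not_implyP[vw /negP]] := bad m.
  by rewrite -ltNge => ?; exists v.
have vw : v @ \oo --> w.
  have FF : Filter (v @ \oo) by exact (fmap_filter v _).
  apply: (@cvg_config E plus d (v @ \oo) w FF) => x.
  have [k xk] := fset_sub_box [fset x]%fset.
  exists k => //= m km; have [+ _] := vP m; apply => /=.
  by apply: (fsubsetP (subset_box d km)); apply: (fsubsetP xk); rewrite inE.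
have /cvgrPdist_le/(_ _ e0)[k _ /(_ k (leqnn k))] : h \o v @ \oo --> h w.
  exact: (cvg_comp v h vw hw).
by have [_ +] := vP k; rewrite /= distrC ltNge => /negP.
Qed.

(** The conditional probability is a mean of the kernel over configurations that
    equal w on W; off the origin they are close to w, and the kernel does not
    see the origin. *)
Lemma cond_spin_cvg w e (eps : R) :
  {for w, continuous (spin_kern g e)} -> 0 < eps ->
  exists m, forall W, 0 \notin W -> (box d m `<=` 0 |` W)%fset ->
    `|cond_spin nu W e w - spin_kern g e w| <= eps.
Proof.
move=> qw eps0; have [m mP] := continuous_near_box qw eps0.
exists m => W W0 /fsubsetP mW.
have qv v : agree [set` W] v w -> `|spin_kern g e v - spin_kern g e w| <= eps.
  (* The spin of v at the origin is unconstrained; reset it to that of w. *)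
  move=> vw; rewrite (@spin_kern_agree _ _ _ _ _ _ _ (set_spin (w 0) v)).
    apply: mP => x /mW; rewrite !inE /set_spin.
    by case: eqP => [-> //|_ /= xW]; exact: vw.
  by move=> x; rewrite /off /= /set_spin; case: eqP => // ->; rewrite inE eqxx.
have q0 : 0 <= spin_kern g e w.
  by have [a a0 /(_ e w)/andP[+ _]] := spin_kern_bounds g_non_null;
    apply: le_trans; exact: ltW.
have := @cond_spin_bounds W e w (Num.max 0 (spin_kern g e w - eps))
  (spin_kern g e w + eps) W0.
rewrite le_max lexx => /(_ isT) h.
have {h} : Num.max 0 (spin_kern g e w - eps) <= cond_spin nu W e w
    <= spin_kern g e w + eps.
  apply: h => v vw; have := qv v vw; rewrite ler_distlC => /andP[h1 h2].
  apply/andP; split.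
    rewrite ge_max; apply/andP; split.
      by have [a a0 /(_ e v)/andP[+ _]] := spin_kern_bounds g_non_null;
        apply: le_trans; exact: ltW.
    lra.
  lra.
by rewrite ge_max ler_distlC => /andP[/andP[_ h1] h2]; apply/andP; split; lra.
Qed.

End conditional_spin.

(** * The logarithmic ratio and its limit *)

Section log_ratio.
Variables (R : realType) (E : finType) (plus : E) (d : nat).
Local Notation Omega := (config plus d).
Implicit Types (w v : Omega) (x y : lattice d) (V W L D : {fset lattice d}).
Local Open Scope ring_scope.

(** The effect on the nu-log-likelihood of turning the spin at the origin into +,
    when all later spins already are + . *)
Definition log_ratio (nu : probability Omega R) W (s : Omega) : R :=
  ln (cond_spin nu W (s 0) (plus_future s))
  - ln (cond_spin nu W plus (plus_future s)).

Definition kern_log_ratio (g : specification R plus d) (s : Omega) : R :=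
  ln (spin_kern g (s 0) (plus_future s)) - ln (spin_kern g plus (plus_future s)).

Lemma log_ratio_local nu W : local_on (0 |` W)%fset (log_ratio nu W).
Proof.
move=> s t st; rewrite /log_ratio.
have -> : s 0 = t 0 by apply: st; rewrite /= fset1U1.
by congr (ln _ - ln _); apply: cond_spin_local => x xW; rewrite /plus_future;
  case: ifP => // _; apply: st; rewrite /= inE xW orbT.
Qed.

Lemma kern_log_ratio_measurable g : measurable_fun setT (kern_log_ratio g).
Proof.
have mq e : measurable_fun setT (fun s : Omega => spin_kern g e (plus_future s)).
  apply: measurableT_comp; first exact: spin_kern_measurable.
  apply: continuous_measurable_config; exact: plus_future_continuous.
rewrite /kern_log_ratio; apply: measurable_funB; last first.
  by apply: measurableT_comp => //; exact: measurable_ln.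
(* The spin at the origin selects the kernel: sum over its values. *)
have -> : (fun s => ln (spin_kern g (s 0) (plus_future s))) =
    (fun s : Omega => \sum_e \1_[set v : Omega | v 0 = e] s
       * ln (spin_kern g e (plus_future s))).
  apply/funext => s; rewrite (bigD1 (s 0)) //= big1 ?addr0.
    by rewrite indicE mem_set ?mul1r.
  by move=> e /eqP se; rewrite indicE memNset ?mul0r //= => h; exact: se.
apply: measurable_sum => e; apply: measurable_funM.
  by apply: measurable_indic; exact: spin_measurable.
by apply: measurableT_comp => //; exact: measurable_ln.
Qed.

Variables (g : specification R plus d) (nu mu : probability Omega R).
Hypotheses (g_non_null : non_null g) (nu_gibbs : gibbs g nu)
  (nu_inv : translation_invariant nu) (mu_inv : translation_invariant mu).

(** All the conditional probabilities, and the kernel, lie in [a, 1]. *)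
Lemma log_ratio_bounded : exists C : R,
  (forall W s, 0 \notin W -> `|log_ratio nu W s| <= C) /\
  (forall s, `|kern_log_ratio g s| <= C).
Proof.
have [a a0 qa] := spin_kern_bounds g_non_null.
have lnB (p q : R) : a <= p <= 1 -> a <= q <= 1 -> `|ln p - ln q| <= - ln a.
  have lnb r : a <= r <= 1 -> ln a <= ln r <= 0.
    move=> /andP[ar r1]; rewrite ler_ln ?posrE ?(lt_le_trans a0) // ar.
    by rewrite ln_le0.
  move=> /lnb/andP[h1 h2] /lnb/andP[h3 h4].
  by rewrite ler_norml; apply/andP; split; lra.
exists (- ln a); split=> [W s W0|s]; apply: lnB; rewrite ?qa //;
  exact: (cond_spin_bounds g_non_null nu_gibbs nu_inv W0 (ltW a0)).
Qed.

Lemma log_ratio_cvg s (W : nat -> {fset lattice d}) :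
  past_continuity_set g s -> (forall n, 0 \notin W n) ->
  (forall n, (box d n `<=` 0 |` W n)%fset) ->
  (fun n => log_ratio nu (W n) s) @ \oo --> kern_log_ratio g s.
Proof.
move=> gs W0 nW.
have [a a0 qa] := spin_kern_bounds g_non_null.
have qc e : {for plus_future s, continuous (spin_kern g e)}.
  have le : local_on [fset 0]%fset (\1_[set v : Omega | v 0 = e] : Omega -> R).
    move=> u v uv; rewrite !indicE; congr (_%:R); congr nat_of_bool.
    have uv0 : u 0 = v 0 by apply: uv; rewrite /= inE.
    by apply/idP/idP => /set_mem us; apply/mem_set; move: us; rewrite /= uv0.
  have := gs [fset 0]%fset _ (ex_intro _ [fset 0]%fset (local_config_on le)).
  congr (continuous_at _ _); apply/funext => v.
  transitivity (fine (\int[g [fset 0%R]%fset v]_x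
     (\1_[set v : Omega | v 0%R = e] x)%:E)%E); first by [].
  by rewrite integral_indic ?setIT //; exact: spin_measurable.
have cc e : (fun n => ln (cond_spin nu (W n) e (plus_future s))) @ \oo -->
    ln (spin_kern g e (plus_future s)).
  apply: (cvg_comp (fun n => cond_spin nu (W n) e (plus_future s)) (@ln R)).
    apply/cvgrPdist_le => eps eps0.
    have [m mP] := cond_spin_cvg g_non_null nu_gibbs nu_inv (qc e) eps0.
    exists m => // n mn; rewrite /= distrC; apply: mP => //.
    exact: fsubset_trans (subset_box d mn) (nW n).
  apply: continuous_ln.
  by have /andP[+ _] := qa e (plus_future s); exact: lt_le_trans.
exact: cvgB.
Qed.

Lemma integrable_log_ratio W : mu.-integrable setT (EFin \o log_ratio nu W).
Proof.
by apply: (local_integrable _ (@log_ratio_local nu W)); exact: probability_setT.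
Qed.

Lemma integrable_kern_log_ratio : mu.-integrable setT (EFin \o kern_log_ratio g).
Proof.
have [C [_ kC]] := log_ratio_bounded.
apply: (bounded_integrable _ (kern_log_ratio_measurable g) kC).
exact: probability_setT.
Qed.

(** Convergence along all finite sets, not along one sequence: a failure would
    produce a sequence of sets, one above each box, contradicting dominated
    convergence. *)
Lemma integral_log_ratio_cvg (eps : R) :
  mu (past_continuity_set g) = 1%E -> 0 < eps ->
  exists m, forall W, 0 \notin W -> (box d m `<=` 0 |` W)%fset ->
    `|\int[mu]_s log_ratio nu W s - \int[mu]_s kern_log_ratio g s| <= eps.
Proof.
move=> mu_past eps0; apply: contrapT => /forallNP bad.
have /choice[W WP] : forall m, exists W, [/\ 0 \notin W,
    (box d m `<=` 0 |` W)%fset &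
    eps < `|\int[mu]_s log_ratio nu W s - \int[mu]_s kern_log_ratio g s|].
  move=> m; have /existsNP[W] := bad m.
  move=> /not_implyP[W0 /not_implyP[mW /negP]].
  by rewrite -ltNge => ?; exists W.
have [C [lC _]] := log_ratio_bounded.
have [] := @dominated_convergence _ Omega R mu setT measurableT
  (fun n s => (log_ratio nu (W n) s)%:E) (fun s => (kern_log_ratio g s)%:E)
  (cst C%:E).
- by move=> n; apply/measurable_EFinP; apply: local_measurable; exact: log_ratio_local.
- by apply/measurable_EFinP; exact: kern_log_ratio_measurable.
- exists (~` past_continuity_set g); split.
  + apply: measurableC; exact: past_continuity_set_measurable.
  + have := probability_setC mu (past_continuity_set_measurable g).
    by rewrite mu_past subee // => ->.
  + move=> s /=; apply: contra_not => gs _; apply: cvg_EFin => //.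
      exact: nearW.
    by apply: log_ratio_cvg => // n; have [] := WP n.
- by apply: finite_measure_integrable_cst.
- apply: aeW => s n _ /=; rewrite lee_fin; apply: lC.
  by have [] := WP n.
move=> _ _.
rewrite -[X in _ --> X](@fineK _ (\int[mu]_s (kern_log_ratio g s)%:E)%E); last first.
  exact: integrable_fin_num integrable_kern_log_ratio.
move=> /fine_cvg /cvgrPdist_le /(_ _ eps0)[n _ /(_ n (leqnn n)) /=].
rewrite distrC => h; have [_ _] := WP n.
by rewrite ltNge => /negP; apply.
Qed.

End log_ratio.

(** * Convergence of the log-likelihood of the reference measure *)

Section telescoped_log_likelihood.
Variables (R : realType) (E : finType) (plus : E) (d : nat).
Local Notation Omega := (config plus d).
Implicit Types (w v : Omega) (x y : lattice d) (V W L D : {fset lattice d}).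
Local Open Scope ring_scope.

Lemma integral_translate (mu : probability Omega R) x D (G : Omega -> R) :
  translation_invariant mu -> local_on D G ->
  \int[mu]_s G (translate x s) = \int[mu]_s G s.
Proof.
move=> mu_inv lG; congr fine.
have mt : measurable_fun setT (translate x : Omega -> Omega).
  by apply: continuous_measurable_config; exact: translate_continuous.
have lGt : local_on (fset_translate D x) (G \o translate x).
  move=> u v uv; apply: lG => y yD; rewrite /translate; apply: uv.
  by rewrite /= in_fset_translate addrAC subrr add0r.
have := @integral_pushforward _ _ Omega Omega R _ mt mu setT (EFin \o G).
rewrite preimage_setT => <- //.
- apply: (eq_measure_integral mu) => A mA _; exact: mu_inv.
- by apply/measurable_EFinP; exact: local_measurable lG.
- by apply: local_integrable lGt; exact: probability_setT.
Qed.

Lemma Rintegral_sum_seq (mu : probability Omega R) (I : eqType) (r : seq I)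
    (f : I -> Omega -> R) :
  (forall i, mu.-integrable setT (EFin \o f i)) ->
  \int[mu]_s (\sum_(i <- r) f i s) = \sum_(i <- r) \int[mu]_s f i s.
Proof.
move=> fi; elim: r => [|i r IH].
  rewrite big_nil /Rintegral.
  by under eq_integral do rewrite big_nil; rewrite integral0.
rewrite big_cons -IH -RintegralD //; last first.
  rewrite (_ : EFin \o _ = fun s => \sum_(j <- r) (f j s)%:E)%E.
    by apply: integrable_sum => // j _; exact: fi.
  by apply/funext => s /=; rewrite sumEFin.
by congr fine; apply: eq_integral => s _; rewrite big_cons.
Qed.

Variables (g : specification R plus d) (nu mu : probability Omega R).
Hypotheses (g_non_null : non_null g) (nu_gibbs : gibbs g nu)
  (nu_inv : translation_invariant nu) (mu_inv : translation_invariant mu).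

Lemma log_ratioE W s : 0 \notin W ->
  log_ratio nu W s =
  ln (cyl_prob nu (0 |` W)%fset (plus_future s))
  - ln (cyl_prob nu (0 |` W)%fset (set_spin plus (plus_future s))).
Proof.
move=> W0; have pos := gibbs_cyl_prob_gt0 g_non_null nu_gibbs nu_inv.
have s0 : s 0 = plus_future s 0 by rewrite /plus_future lex_le_refl.
rewrite /log_ratio /cond_spin !ln_div ?posrE // s0 set_spin_id.
by rewrite opprB addrA subrK.
Qed.

(** The configuration [mix D] follows s on D and is + elsewhere. Adding the sites
    of L in increasing order, the step at x compares two configurations that
    differ at x only; seen from x, they are the two in [log_ratioE]. *)
Lemma log_likelihood_telescope L s :
  ln (cyl_prob nu L s) - ln (cyl_prob nu L (all_plus plus)) =
  \sum_(x <- L)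
    log_ratio nu (fset_translate L (- x) `\ 0)%fset (translate x s).
Proof.
pose mix D : Omega := fun y => if y \in D then s y else plus.
have := telescope_fset (@lex_le_refl d) (@lex_le_anti d) (@lex_le_trans d)
  (@lex_le_total d) (fun D => ln (cyl_prob nu L (mix D))) L.
have -> : cyl_prob nu L (mix L) = cyl_prob nu L s.
  by apply: cyl_prob_agree => y /= yL; rewrite /mix yL.
have -> : mix fset0 = all_plus plus by apply/funext => y; rewrite /mix inE.
move=> <-; rewrite [LHS]big_seq [RHS]big_seq; apply: eq_bigr => x xL.
rewrite log_ratioE; last by rewrite !inE eqxx.
rewrite -translate0 //; congr (ln _ - ln _);
  rewrite -(cyl_prob_translate L x _ nu_inv); apply: cyl_prob_agree => y /=;
  rewrite in_fset_translate opprK => yL.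
  rewrite /translate /mix /plus_future !inE /= [x + y]addrC yL /=.
  by rewrite (lex_le_sub x) addrK.
rewrite /translate /mix /set_spin /plus_future !inE /= [x + y]addrC yL /=.
have -> : (y + x == x) = (y == 0) by rewrite -subr_eq0 addrK.
rewrite (lex_le_sub x) addrK.
by case: (y == 0); rewrite ?andbF ?andbT.
Qed.

Lemma integral_log_likelihood L :
  \int[mu]_s (ln (cyl_prob nu L s) - ln (cyl_prob nu L (all_plus plus))) =
  \sum_(x <- L)
    \int[mu]_s log_ratio nu (fset_translate L (- x) `\ 0)%fset s.
Proof.
transitivity (\int[mu]_s \sum_(x <- L)
    log_ratio nu (fset_translate L (- x) `\ 0)%fset (translate x s)).
  by congr fine; apply: eq_integral => s _; rewrite log_likelihood_telescope.
rewrite Rintegral_sum_seq.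
  apply: eq_bigr => x _; apply: (integral_translate x mu_inv).
  exact: log_ratio_local.
move=> x; set W := (_ `\ 0)%fset.
apply: (@local_integrable _ _ _ _ mu _ (fset_translate (0 |` W)%fset x)).
  exact: probability_setT.
move=> u v uv; apply: log_ratio_local => y yW; rewrite /translate; apply: uv.
by rewrite /= in_fset_translate addrAC subrr add0r.
Qed.

Lemma log_likelihood_cvg : mu (past_continuity_set g) = 1%E ->
  (fun n => (#|` box d n|)%:R^-1 * \int[mu]_s (ln (cyl_prob nu (box d n) s)
     - ln (cyl_prob nu (box d n) (all_plus plus)))) @ \oo
  --> \int[mu]_s kern_log_ratio g s.
Proof.
move=> mu_past; under eq_fun do rewrite integral_log_likelihood.
have [C [lC _]] := log_ratio_bounded g_non_null nu_gibbs nu_inv.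
apply: (@cesaro_box _ _ (fun V => \int[mu]_s log_ratio nu (V `\ 0)%fset s) _ C).
  move=> V; have V0 : 0 \notin (V `\ 0)%fset by rewrite !inE eqxx.
  rewrite (le_trans (le_normr_Rintegral _ _)) //.
    exact: integrable_log_ratio.
  rewrite -[leRHS]mulr1 -[1](_ : fine (mu setT) = 1); last first.
    by rewrite probability_setT.
  rewrite -Rintegral_cst //; apply: le_Rintegral => //.
  - by apply: integrable_norm; exact: integrable_log_ratio.
  - exact: finite_measure_integrable_cst.
  - by move=> s _; exact: lC.
move=> e e0.
have [m mP] := integral_log_ratio_cvg g_non_null nu_gibbs nu_inv mu_past e0.
exists m => V mV; apply: mP; first by rewrite !inE eqxx.
apply: (fsubset_trans mV); apply/fsubsetP => x xV.
by rewrite !inE xV andbT orbN.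
Qed.

End telescoped_log_likelihood.

(** * Existence of the entropy density *)

Section entropy_density.
Variables (R : realType) (E : finType) (plus : E) (d : nat).
Local Notation Omega := (config plus d).
Implicit Types (w v : Omega) (x y : lattice d) (V W L D : {fset lattice d}).
Local Open Scope ring_scope.
Variable mu : probability Omega R.

Lemma Rintegral_local D (G : Omega -> R) : local_on D G ->
  \int[mu]_s G s =
  \sum_(s : {ffun D -> E}) G (extend s) * cyl_prob mu D (extend s).
Proof.
move=> lG; rewrite /Rintegral (local_integral (probability_setT mu) lG).
rewrite -[RHS]/(fine (_%:E)) -sumEFin; congr fine; apply: eq_bigr => s _.
by rewrite EFinM -cyl_probE restr_extend.
Qed.

Lemma Rintegral_const (c : R) : \int[mu]_s c = c.
Proof.
transitivity (c * fine (mu setT)); last by rewrite probability_setT mulr1.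
exact: Rintegral_cst.
Qed.

(** Null cylinders have to be excluded in the comparison of logarithms, since
    [ln 0] is 0. *)
Lemma le_Rintegral_local D (G H : Omega -> R) : local_on D G -> local_on D H ->
  (forall s, 0 < cyl_prob mu D s -> G s <= H s) ->
  \int[mu]_s G s <= \int[mu]_s H s.
Proof.
move=> lG lH GH; rewrite (Rintegral_local lG) (Rintegral_local lH).
apply: ler_sum => s _; have := cyl_prob_ge0 mu D (extend s).
rewrite le_eqVlt => /orP[/eqP <-|p0]; first by rewrite !mulr0.
by rewrite ler_wpM2r ?GH // ltW.
Qed.

(** Conditioning on the spins in W. On null cylinders both sides vanish, whatever
    the value of the quotient in [cond_spin]. *)
Lemma Rintegral_spin W e (Y : Omega -> R) : 0 \notin W -> local_on W Y ->
  \int[mu]_(s in [set s : Omega | s 0 = e]) Y s =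
  \int[mu]_s (Y s * cond_spin mu W e s).
Proof.
move=> W0 lY; rewrite (@Rintegral_local W); last first.
  by move=> u v uv; rewrite (lY _ _ uv) (cond_spin_local mu e uv).
rewrite /Rintegral (local_integral_in (probability_setT mu) _ lY); last first.
  exact: spin_measurable.
rewrite -[RHS]/(fine (_%:E)) -sumEFin; congr fine; apply: eq_bigr => s _.
rewrite -mulrA EFinM; congr (_ * _)%E.
rewrite -[s in cylinder s](@restr_extend E plus) -cyl_set_spin //.
apply: (etrans (cyl_probE mu _ _)); congr _%:E.
rewrite /cond_spin; have [p0|p0] := eqVneq (cyl_prob mu W (extend s)) 0.
  rewrite p0 mulr0; apply: le_anti; rewrite cyl_prob_ge0 andbT -p0.
  rewrite -(sum_cyl_prob_spin mu _ W0) (bigD1 e) //= lerDl.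
  by apply: sumr_ge0 => f _; exact: cyl_prob_ge0.
by rewrite divfK.
Qed.

Lemma cond_spin_ge0 W e w : 0 <= cond_spin mu W e w.
Proof. by rewrite divr_ge0 ?cyl_prob_ge0. Qed.

Lemma sum_cond_spin_le1 W w : 0 \notin W -> \sum_e cond_spin mu W e w <= 1.
Proof.
move=> W0; rewrite -mulr_suml sum_cyl_prob_spin //.
have [->|p0] := eqVneq (cyl_prob mu W w) 0; first by rewrite mul0r.
by rewrite divff.
Qed.

Definition own_cond W (s : Omega) : R := cond_spin mu W (s 0) s.

Lemma own_condE W s :
  own_cond W s = cyl_prob mu (0 |` W)%fset s / cyl_prob mu W s.
Proof. by rewrite /own_cond /cond_spin set_spin_id. Qed.

Lemma own_cond_local W : local_on (0 |` W)%fset (own_cond W).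
Proof.
move=> s t st; rewrite /own_cond.
have -> : s 0 = t 0 by apply: st; rewrite /= fset1U1.
by apply: cond_spin_local => x xW; apply: st; rewrite /= inE xW orbT.
Qed.

(** Given the spins in W', the mean of p_W / p_W' under p_W' is the total mass of
    p_W on the support of p_W'. *)
Lemma integral_cond_ratio_le1 W W' : (W `<=` W')%fset -> 0 \notin W' ->
  \int[mu]_s (own_cond W s / own_cond W' s) <= 1.
Proof.
move=> WW' W0'; have W0 : 0 \notin W by apply: contra W0'; exact/fsubsetP.
pose Y e s := cond_spin mu W e s / cond_spin mu W' e s.
have lY e : local_on W' (Y e).
  move=> u v uv; rewrite /Y (cond_spin_local mu e uv); congr (_ / _).
  by apply: local_on_sub uv; [exact: WW'|exact: cond_spin_local].
pose A e := [set s : Omega | s 0 = e].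
have lYA e : local_on (0 |` W')%fset (Y e \_ (A e)).
  move=> u v uv; rewrite !patchE.
  have uv0 : u 0 = v 0 by apply: uv; rewrite /= fset1U1.
  rewrite (_ : (u \in A e) = (v \in A e)); last first.
    by apply/idP/idP => /set_mem ?; apply/mem_set; rewrite /A /= ?uv0 // -uv0.
  case: ifP => // _; apply: lY => x xW; apply: uv.
  by rewrite /= inE xW orbT.
have -> : \int[mu]_s (own_cond W s / own_cond W' s) =
    \int[mu]_s \sum_e (Y e \_ (A e)) s.
  congr fine; apply: eq_integral => s _; rewrite (bigD1 (s 0)) //= big1.
    by rewrite addr0 patchE mem_set.
  by move=> e /eqP es; rewrite patchE memNset // => h; exact: es.
rewrite Rintegral_sum_seq; last first.
  by move=> e; apply: local_integrable (lYA e); exact: probability_setT.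
have -> : \sum_e \int[mu]_s (Y e \_ (A e)) s =
    \sum_e \int[mu]_s (Y e s * cond_spin mu W' e s).
  by apply: eq_bigr => e _; rewrite -Rintegral_mkcond; exact: Rintegral_spin.
have lYc e : local_on W' (fun s => Y e s * cond_spin mu W' e s).
  by move=> u v uv; rewrite (lY _ _ _ uv) (cond_spin_local mu e uv).
rewrite -Rintegral_sum_seq; last first.
  by move=> e; apply: local_integrable (lYc e); exact: probability_setT.
rewrite [leRHS](_ : _ = \int[mu]_s 1); last first.
  exact/esym/Rintegral_const.
apply: (@le_Rintegral_local W') => // [u v uv|s _].
  by apply: eq_bigr => e _; exact: lYc.
apply: le_trans (sum_cond_spin_le1 s W0); apply: ler_sum => e _.
rewrite /Y; have [->|c0] := eqVneq (cond_spin mu W' e s) 0.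
  by rewrite mulr0 cond_spin_ge0.
by rewrite divfK.
Qed.

(** Minus the entropy of the marginal of mu on V. *)
Definition mean_log V : R := \int[mu]_s ln (cyl_prob mu V s).

(** Minus the conditional entropy of the spin at the origin given the spins in
    W. *)
Definition mean_log_incr W : R := mean_log (0 |` W)%fset - mean_log W.

Lemma log_cyl_prob_local V W : (V `<=` W)%fset ->
  local_on W (fun s => ln (cyl_prob mu V s)).
Proof.
move=> VW; apply: (local_on_sub VW) => u v uv.
by rewrite (cyl_prob_local mu uv).
Qed.

Lemma log_cyl_prob_integrable V :
  mu.-integrable setT (EFin \o (fun s => ln (cyl_prob mu V s))).
Proof.
apply: local_integrable (log_cyl_prob_local (fsubset_refl V)).
exact: probability_setT.
Qed.

Lemma mean_log_incrE W :
  mean_log_incr W = \int[mu]_s (ln (cyl_prob mu (0 |` W)%fset s)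
                                - ln (cyl_prob mu W s)).
Proof. by rewrite RintegralB //; exact: log_cyl_prob_integrable. Qed.

Lemma mean_log_incr_le0 W : mean_log_incr W <= 0.
Proof.
rewrite subr_le0; apply: (@le_Rintegral_local (0 |` W)%fset).
- exact: log_cyl_prob_local.
- by apply: log_cyl_prob_local; exact: fsubsetU1.
move=> s p0; have pm := cyl_prob_mono mu s (fsubsetU1 0 W).
by rewrite ler_ln ?posrE // (lt_le_trans p0).
Qed.

(** Conditioning on more spins lowers the entropy. By [ln t <= t - 1] the
    difference is at most the mean of the ratio of the two conditional
    probabilities, minus 1, which is [integral_cond_ratio_le1]. *)
Lemma mean_log_incr_mono W W' : (W `<=` W')%fset -> 0 \notin W' ->
  mean_log_incr W <= mean_log_incr W'.
Proof.
move=> WW' W0'; set D := (0 |` W')%fset.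
have WD : (W' `<=` D)%fset by exact: fsubsetU1.
have WD0 : (0 |` W `<=` D)%fset by rewrite fsetUS.
have WDW : (W `<=` D)%fset := fsubset_trans WW' WD.
pose G s := ln (cyl_prob mu (0 |` W)%fset s) - ln (cyl_prob mu W s).
pose H s := ln (cyl_prob mu D s) - ln (cyl_prob mu W' s).
pose Q s := own_cond W s / own_cond W' s.
have lG : local_on D G.
  by move=> u v uv; rewrite /G; congr (ln _ - ln _); apply: cyl_prob_agree => x xW;
    apply: uv; [exact: (fsubsetP WD0)|exact: (fsubsetP WDW)].
have lH : local_on D H.
  by move=> u v uv; rewrite /H; congr (ln _ - ln _); apply: cyl_prob_agree => x xW;
    apply: uv => //; exact: (fsubsetP WD).
have lQ : local_on D Q.
  move=> u v uv; rewrite /Q (own_cond_local uv); congr (_ / _).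
  by apply: own_cond_local => x xW; apply: uv; exact: (fsubsetP WD0).
have int := fun F lF => @local_integrable _ _ _ _ mu (probability_setT mu) D F lF.
have i1 : mu.-integrable setT (EFin \o cst (1 : R)) by exact: finite_measure_integrable_cst.
have GHQ : \int[mu]_s (G s - H s) <= \int[mu]_s (Q s - 1).
  apply: (@le_Rintegral_local D).
  - by move=> u v uv; rewrite (lG _ _ uv) (lH _ _ uv).
  - by move=> u v uv; rewrite (lQ _ _ uv).
  move=> s p0.
  have p1 : 0 < cyl_prob mu W' s := lt_le_trans p0 (cyl_prob_mono _ _ WD).
  have p2 : 0 < cyl_prob mu (0 |` W)%fset s := lt_le_trans p0 (cyl_prob_mono _ _ WD0).
  have p3 : 0 < cyl_prob mu W s := lt_le_trans p0 (cyl_prob_mono _ _ WDW).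
  have Q0 : 0 < Q s by rewrite /Q !own_condE !divr_gt0.
  have -> : G s - H s = ln (Q s).
    by rewrite /Q !own_condE !ln_div ?posrE // divr_gt0.
  rewrite -[in leLHS](subrKC 1 (Q s)) le_ln1Dx //; lra.
rewrite !mean_log_incrE -/G -/H -subr_ge0 -oppr_le0 opprB.
rewrite -RintegralB //; [|exact: int|exact: int].
apply: (le_trans GHQ); rewrite RintegralB //; last exact: int.
rewrite Rintegral_const subr_le0.
exact: integral_cond_ratio_le1.
Qed.

Definition past V : {fset lattice d} :=
  [fset y in V | lex_le y 0 && (y != 0)]%fset.

Hypothesis mu_inv : translation_invariant mu.

Lemma mean_log_translate V x : mean_log (fset_translate V (- x)) = mean_log V.
Proof.
rewrite /mean_log -(integral_translate x mu_inv
  (log_cyl_prob_local (fsubset_refl (fset_translate V (- x))))).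
by congr fine; apply: eq_integral => s _; rewrite cyl_prob_translate.
Qed.

Lemma mean_log_telescope L :
  mean_log L = \sum_(x <- L) mean_log_incr (past (fset_translate L (- x))).
Proof.
have := telescope_fset (@lex_le_refl d) (@lex_le_anti d) (@lex_le_trans d)
  (@lex_le_total d) mean_log L.
have -> : mean_log fset0 = 0.
  rewrite /mean_log /Rintegral.
  by under eq_integral do rewrite cyl_prob0 ln1; rewrite integral0.
rewrite subr0 => <-; rewrite [LHS]big_seq [RHS]big_seq; apply: eq_bigr => x xL.
rewrite /mean_log_incr; congr (_ - _); rewrite -[LHS](mean_log_translate _ x);
  congr mean_log; apply/fsetP => y; rewrite !inE !in_fset_translate opprK !inE /=.
  rewrite (lex_le_sub x) addrK.
  by have [->|_] := eqVneq y 0; rewrite ?add0r ?xL ?lex_le_refl ?andbT.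
rewrite (lex_le_sub x) addrK; congr (_ && (_ && ~~ _)).
by rewrite -subr_eq0 addrK.
Qed.

Lemma mean_log_cvg : exists l : R,
  (fun n => (#|` box d n|)%:R^-1 * mean_log (box d n)) @ \oo --> l.
Proof.
pose u m := mean_log_incr (past (box d m)).
have pastS V V' : (V `<=` V')%fset -> (past V `<=` past V')%fset.
  move=> /fsubsetP VV'; apply/fsubsetP => y; rewrite !inE => /andP[/VV' -> ->].
  by [].
have past0 V : 0 \notin past V by rewrite !inE eqxx andbF andbF.
have u_nd : nondecreasing_seq u.
  by move=> m n mn; apply: mean_log_incr_mono => //; exact/pastS/subset_box.
have u_cvg : cvgn u.
  apply: nondecreasing_is_cvgn => //; exists 0 => _ [m _ <-].
  exact: mean_log_incr_le0.
exists (limn u); under eq_fun do rewrite mean_log_telescope.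
apply: (@cesaro_box _ _ (fun V => mean_log_incr (past V)) _
    `|mean_log_incr fset0|).
  move=> V; rewrite ler0_norm ?mean_log_incr_le0 //.
  rewrite ler0_norm ?mean_log_incr_le0 // lerN2.
  by apply: mean_log_incr_mono.
move=> e e0; have /cvgrPdist_le/(_ _ e0)[m _ /(_ m (leqnn m)) /= um] := u_cvg.
exists m => V mV; have [k Vk] := fset_sub_box V.
have h1 : u m <= mean_log_incr (past V) by apply: mean_log_incr_mono; rewrite ?pastS.
have h2 : mean_log_incr (past V) <= u k by apply: mean_log_incr_mono; rewrite ?pastS.
have h3 : u k <= limn u by exact: nondecreasing_cvgn_le.
move: um; rewrite ler_norml => /andP[_ um].
by rewrite ler_norml; apply/andP; split; lra.
Qed.

End entropy_density.

(** * Extended-real densities and the variational formula *)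

Section densities.
Variables (R : realType) (E : finType) (plus : E) (d : nat).
Local Notation Omega := (config plus d).
Implicit Types (w v s : Omega) (L : {fset lattice d}) (n : nat).
Implicit Type mu nu : probability Omega R.

Lemma cylinder_probE mu L (s : {ffun L -> E}) :
  mu (cylinder s) = (cyl_prob mu L (extend s))%:E.
Proof. by rewrite -cyl_probE restr_extend. Qed.

Lemma mule_lne (p : R) : (0 <= p)%R -> p%:E * lne p%:E = (ln p * p)%:E.
Proof.
rewrite le_eqVlt => /orP[/eqP <-|p0]; first by rewrite mul0e mulr0.
by rewrite lne_EFin // muleC.
Qed.

Lemma mule_lne_div (p q : R) : (0 <= p)%R -> (0 < q)%R ->
  p%:E * lne (p%:E / q%:E) = ((ln p - ln q) * p)%:E.
Proof.
rewrite le_eqVlt => /orP[/eqP <- _|p0 q0]; first by rewrite mul0e mulr0.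
by rewrite inver gt_eqF // -EFinM lne_EFin ?divr_gt0 // ln_div ?posrE // muleC.
Qed.

Lemma volumeV n : (volume R d n)^-1 = ((#|` box d n|)%:R^-1)%:E.
Proof. by rewrite /volume inver pnatr_eq0 card_box expn_eq0. Qed.

Lemma entropy_densityE mu n :
  (volume R d n)^-1 * \sum_(s : {ffun box d n -> E})
    mu (cylinder s) * lne (mu (cylinder s)) =
  ((#|` box d n|)%:R^-1 * mean_log mu (box d n))%:E.
Proof.
rewrite volumeV EFinM; congr (_ * _).
rewrite /mean_log (@Rintegral_local _ _ _ _ _ (box d n)); last first.
  by apply: log_cyl_prob_local; exact: fsubset_refl.
rewrite -sumEFin; apply: eq_bigr => s _.
by rewrite cylinder_probE mule_lne ?cyl_prob_ge0.
Qed.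

Lemma log_plus_densityE nu n :
  (forall w, 0 < cyl_prob nu (box d n) w)%R ->
  log_plus_density nu n =
  ((#|` box d n|)%:R^-1 * ln (cyl_prob nu (box d n) (all_plus plus)))%:E.
Proof.
by move=> pos; rewrite /log_plus_density volumeV /plus_prob cyl_probE lne_EFin.
Qed.

Lemma log_plus_ratioE mu nu n :
  (forall w, 0 < cyl_prob mu (box d n) w)%R ->
  (forall w, 0 < cyl_prob nu (box d n) w)%R ->
  (volume R d n)^-1 * lne (plus_prob mu n / plus_prob nu n) =
  ((#|` box d n|)%:R^-1 * (ln (cyl_prob mu (box d n) (all_plus plus))
    - ln (cyl_prob nu (box d n) (all_plus plus))))%:E.
Proof.
move=> pm pn; rewrite volumeV /plus_prob !cyl_probE inver gt_eqF // -EFinM.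
by rewrite lne_EFin ?divr_gt0 // ln_div ?posrE.
Qed.

(** Absolute continuity of the marginals holds because every cylinder is
    nu-charged: a nu-null event of the box is empty. *)
Lemma relative_entropy_densityE mu nu n :
  (forall w, 0 < cyl_prob nu (box d n) w)%R ->
  relative_entropy_density mu nu n =
  ((#|` box d n|)%:R^-1 * \int[mu]_s (ln (cyl_prob mu (box d n) s)
     - ln (cyl_prob nu (box d n) s)))%:E.
Proof.
move=> pos; rewrite /relative_entropy_density volumeV EFinM; congr (_ * _).
rewrite /relative_entropy_in; case: asboolP => [_|[]]; last first.
  move=> B nuB; suff -> : [set w : Omega | B (restr (box d n) w)] = set0.
    by rewrite measure0.
  rewrite -subset0 => w /= Bw; have := pos w.
  rewrite -lte_fin -cyl_probE => /lt_le_trans nu_gt0.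
  suff /nu_gt0 : nu (cylinder (restr (box d n) w)) <=
      nu [set w : Omega | B (restr (box d n) w)] by rewrite nuB ltxx.
  apply: le_measure.
  - by rewrite inE; exact: cylinder_measurable.
  - rewrite inE (_ : [set w | _] = \bigcup_(s in B) cylinder s); last first.
      apply/seteqP; split=> v /= => [Bv|[s Bs vs]]; first by exists (restr _ v).
      by move: Bs; rewrite -vs.
    apply: fin_bigcup_measurable; first exact: finite_finset.
    by move=> s _; exact: cylinder_measurable.
  - by move=> v vw; rewrite /= vw.
rewrite (@Rintegral_local _ _ _ _ _ (box d n)); last first.
  move=> u v uv; congr (ln _ - ln _)%R; exact: cyl_prob_agree.
rewrite -sumEFin; apply: eq_bigr => s _.
by rewrite !cylinder_probE mule_lne_div ?cyl_prob_ge0.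
Qed.

End densities.

Lemma cvg_EFin_seq (R : realType) (c : nat -> R) (c0 : R) :
  c @ \oo --> c0 -> (EFin \o c) @ \oo --> c0%:E.
Proof. by move=> cc; apply: cvg_EFin => //; exact: nearW. Qed.

(** The sequence l may have an infinite limit; finiteness of c0 makes the
    difference of the limits defined. *)
Lemma cvg_fin_sub (R : realType) (c : nat -> R) (c0 : R) (l : nat -> \bar R)
    (l0 : \bar R) : c @ \oo --> c0 -> l @ \oo --> l0 ->
  (fun n => (c n)%:E - l n) @ \oo --> c0%:E - l0.
Proof.
move=> /cvg_EFin_seq cc ll; apply: cvgeB => //; exact: fin_num_adde_defr.
Qed.

Theorem theorem2 (R : realType) (d : nat) (E : finType) (plus : E)
    (g : specification R plus d) (mu nu : probability (config plus d) R)
    (d_gt0 : (0 < d)%N)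
    (g_non_null : non_null g)
    (g_inv : spec_invariant g)
    (nu_gibbs : gibbs g nu) (nu_inv : translation_invariant nu)
    (mu_inv : translation_invariant mu)
    (mu_past : mu (past_continuity_set g) = 1) :
  ((has_relative_entropy mu nu <-> has_eplus nu) /\
   (has_relative_entropy mu nu ->
    relative_entropy mu nu =
      eplus nu - entropy mu -
      \int[mu]_s
        lne (kern_prob g [fset 0%R]%fset (plus_future s) (plus_future s) /
             kern_prob g [fset 0%R]%fset (all_plus plus) (plus_future s))))
  /\
  (gibbs g mu -> has_eplus nu ->
   (fun n => (volume R d n)^-1 * lne (plus_prob mu n / plus_prob nu n)) @ \oo
     --> relative_entropy mu nu).
Proof.
have pos := gibbs_cyl_prob_gt0 g_non_null nu_gibbs nu_inv.
set Int := \int[mu]_s lne _.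
pose i : R := (\int[mu]_s kern_log_ratio g s)%R.
have IntE : Int = i%:E.
  rewrite /Int /i fineK; last first.
    by apply: integrable_fin_num => //;
      exact: (integrable_kern_log_ratio mu g_non_null nu_gibbs nu_inv).
  apply: eq_integral => s _; rewrite !kern_probE.
  have [a a0 qa] := spin_kern_bounds g_non_null.
  have q0 e w : (0 < spin_kern g e w)%R.
    by have /andP[+ _] := qa e w; exact: lt_le_trans.
  rewrite inver gt_eqF // -EFinM lne_EFin ?divr_gt0 // ln_div ?posrE //.
  by rewrite /kern_log_ratio /plus_future lex_le_refl.
pose N n : R := (#|` box d n|)%:R.
pose neg_ent n := ((N n)^-1 * mean_log mu (box d n))%R.
pose loglik n := ((N n)^-1 * \int[mu]_s (ln (cyl_prob nu (box d n) s)
  - ln (cyl_prob nu (box d n) (all_plus plus))))%R.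
pose logplus n := ((N n)^-1 * ln (cyl_prob nu (box d n) (all_plus plus)))%R.
have [s0 neg_ent_cvg] := mean_log_cvg mu_inv.
have loglik_cvg : loglik @ \oo --> i.
  exact: (log_likelihood_cvg g_non_null nu_gibbs nu_inv mu_inv mu_past).
have lE : log_plus_density nu = EFin \o logplus.
  by apply/funext => n; rewrite log_plus_densityE.
have rE : relative_entropy_density mu nu = (fun n => (neg_ent n - loglik n)%:E - (logplus n)%:E).
  apply/funext => n; rewrite relative_entropy_densityE // -EFinB; congr _%:E.
  rewrite /neg_ent /loglik /logplus -/(N n) -!mulrBr; congr (_ * _)%R.
  have iln p : mu.-integrable setT
      (EFin \o (fun s => ln (cyl_prob p (box d n) s))).
    apply: local_integrable (log_cyl_prob_local p (fsubset_refl _)).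
    exact: probability_setT.
  rewrite !RintegralB ?Rintegral_const //; first by rewrite /mean_log; lra.
  exact: finite_measure_integrable_cst.
have cn_cvg : (fun n => (neg_ent n - loglik n)%R) @ \oo --> (s0 - i)%R by exact: cvgB.
have r_cvg l : log_plus_density nu @ \oo --> l ->
    relative_entropy_density mu nu @ \oo --> (s0 - i)%:E - l.
  by rewrite rE lE; exact: cvg_fin_sub.
have entE : entropy mu = (- s0)%:E.
  rewrite /entropy (_ : (fun n => _) = EFin \o neg_ent); last first.
    by apply/funext => n; exact: entropy_densityE.
  by rewrite (cvg_lim _ (cvg_EFin_seq neg_ent_cvg)).
split.
  (* The decomposition r = c - l with c convergent is solved for l. *)
  have l_r : has_relative_entropy mu nu -> has_eplus nu.
    move=> /cvg_ex[r rr]; apply/cvg_ex; exists ((s0 - i)%:E - r).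
    rewrite (_ : log_plus_density nu =
      fun n => (neg_ent n - loglik n)%:E - relative_entropy_density mu nu n).
      exact: cvg_fin_sub.
    by apply/funext => n; rewrite rE lE /= -!EFinB opprB addrC subrK.
  split; first by split=> // /cvg_ex[l /r_cvg rl]; apply/cvg_ex; eexists; exact: rl.
  move=> /l_r l_cvg; rewrite /relative_entropy (cvg_lim _ (r_cvg _ l_cvg)) //.
  rewrite /eplus entE IntE (_ : - (- s0)%:E = s0%:E) ?EFinN ?oppeK //.
  by rewrite -addeA -EFinB addeC.
move=> mu_gibbs /[dup] l_cvg /r_cvg rr.
have posm := gibbs_cyl_prob_gt0 g_non_null mu_gibbs mu_inv.
rewrite [X in _ --> X](cvg_lim _ rr) //.
(* The log-likelihood of mu itself has the same limit as that of nu. *)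
pose loglik_mu n := ((N n)^-1 * \int[mu]_s (ln (cyl_prob mu (box d n) s)
  - ln (cyl_prob mu (box d n) (all_plus plus))))%R.
have loglik_mu_cvg : loglik_mu @ \oo --> i.
  exact: (log_likelihood_cvg g_non_null mu_gibbs mu_inv mu_inv mu_past).
have loglik_muE n : loglik_mu n = (neg_ent n - (N n)^-1 *
    ln (cyl_prob mu (box d n) (all_plus plus)))%R.
  rewrite /loglik_mu /neg_ent -mulrBr; congr (_ * _)%R.
  rewrite RintegralB ?Rintegral_const //; first exact: log_cyl_prob_integrable.
  exact: finite_measure_integrable_cst.
rewrite (_ : (fun n => _) = fun n => (neg_ent n - loglik_mu n)%:E - log_plus_density nu n).
  by apply: cvg_fin_sub => //; exact: cvgB.
apply/funext => n; rewrite log_plus_ratioE // lE /= loglik_muE -EFinB; congr _%:E.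
by rewrite /logplus -/(N n); lra.
Qed.
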